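(* Let $m\ge1$ and let $\{F_i^0\}_{i\in\mathbb{Z}}\subset\mathfrak{J}_n$ with $L=\sup_i d_\mu(F_i^0,F_{i+1}^0)<\infty$. Let $F_k$ be the level-$k$ piecewise interpolants of the degree-$m$ set-valued spline subdivision scheme applied to these sets. Then $F_k$ converges uniformly on $\mathbb{R}$ in the metric $d_\mu$ to a set-valued function $F^\infty:\mathbb{R}\to\mathfrak{L}_n$, which satisfies $d_\mu(F^\infty(x),F^\infty(y))\le L|x-y|$ for all $x,y\in\mathbb{R}$.
   Context: Notation: $\mu$ is $n$-dimensional Lebesgue measure; $\operatorname{ci}(E)$ is the closure of the interior of $E$; $\mathfrak{J}_n$ is the family of bounded sets $A\subset\mathbb{R}^n$ with $A=\operatorname{ci}(A)$ and $\mu(\partial A)=0$ (the empty set included); $d_\mu(A,B)=\mu(A\triangle B)$. $\mathfrak{L}_n$ is the complete metric space of Lebesgue measurable subsets of $\mathbb{R}^n$ of finite measure, with metric $d_\mu$ and sets differing by a null set identified; $\mathfrak{J}_n\subset\mathfrak{L}_n$. For nonempty bounded $A$: $d_S(p,A)=d(p,\partial A)$ if $p\in A$, $-d(p,\partial A)$ if $p\notin A$, where $d(q,E)=\min_{e\in E}\|q-e\|$. $O(B,r)=\{p:d(p,B)\le r\}$ for $r\ge0$. Distance average: for nonempty $A,B\in\mathfrak{J}_n$, $x\in\mathbb{R}$, $xA\,\widetilde\oplus\,(1-x)B=\{p: x d_S(p,A)+(1-x)d_S(p,B)\ge0\}$; if $A\ne\emptyset=B$, fix $q\in A$ maximizing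 $d_S(\cdot,A)$ over $A$ and set $xA\,\widetilde\oplus\,(1-x)B=\{p: x d_S(p,A)+(x-1)\|p-q\|\ge0\}$; the distance average of two empty sets is $\emptyset$. Let $h_{A,B}(x)=\mu(xA\,\widetilde\oplus\,(1-x)B)$. $A,B$ satisfy the zero-measure condition if $\mu(\{p: \tfrac12 d_S(p,A)+\tfrac12 d_S(p,B)=0\})=0$. Measure average $tA\oplus(1-t)B$ ($t\in\mathbb{R}$), defined in three steps (a fixed large number $N>0$ and, where needed, a fixed $\varepsilon>0$ are chosen once). Always $tA\oplus(1-t)A=A$. Step 1 (simply different: $B\subsetneq A$, $A\setminus B$ connected). If $A,B$ satisfy the zero-measure condition, or if $t\notin[0,1]$: $tA\oplus(1-t)B=\operatorname{ci}\big(gA\,\widetilde\oplus\,(1-g)B\big)$ where $g\in[-N,N]$ is any point attaining $\inf_{\xi\in[-N,N]}|h_{A,B}(\xi)-(t\mu(A)+(1-t)\mu(B))|$ (the set obtained does not depend on this choice). If the zero-measure condition fails and $t\in[0,1]$: $tA\oplus(1-t)B=\operatorname{ci}(O(B,r)\cap A)$ for any $r\ge0$ with $\mu(O(B,r)\cap A)=t\mu(A)+(1-t)\mu(B)$. Step 2 (nested: $B\subsetneq A$). If $A\setminus B$ has finitely many connected components, for each component $C$ let $R_{C,t}=t(B\cup C)\oplus(1-t)B$ (Step 1), and set $tA\oplus(1-t)B=\bigcup_C R_{C,t}$ for $t\ge0$ and $\operatorname{ci}\big(\bigcap_C R_{C,t}\big)$ for $t<0$. If there are infinitely many components, all components of measure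 $<\varepsilon$ are merged into one set $U$, which is treated as a single component in these formulas. Step 3 (general $A,B$). Let $I=\operatorname{ci}(A\cap B)$, $R_{1,t}=tA\oplus(1-t)I$ and $R_{2,t}=(1-t)B\oplus tI$ (Step 2 averages of nested pairs, weight first on the larger set). Then $tA\oplus(1-t)B=R_{1,t}\cup R_{2,t}$ for $t\in[0,1]$; $=\operatorname{ci}(R_{1,t}\setminus(A\cap B))\cup R_{2,t}$ for $t>1$; and for $t<0$ it is defined as $(1-t)B\oplus tA$, computed by the $t>1$ rule with the roles of $A$ and $B$ exchanged (parameter $1-t>1$). Set-valued spline scheme of degree $m\ge1$: given $\{F_i^k\}_{i\in\mathbb{Z}}\subset\mathfrak{J}_n$, set $F_{2i}^{k+1,0}=F_i^k$, $F_{2i+1}^{k+1,0}=\tfrac12F_i^k\oplus\tfrac12F_{i+1}^k$; for $j=1,\dots,m-1$, $F_i^{k+1,j}=\tfrac12F_i^{k+1,j-1}\oplus\tfrac12F_{i+1}^{k+1,j-1}$; and $F_i^{k+1}=F^{k+1,m-1}_{i-\lfloor(m-1)/2\rfloor}$ ($i\in\mathbb{Z}$, $k=0,1,\dots$). The level-$k$ piecewise interpolant is $F_k(x)=\lambda(x)F_i^k\oplus(1-\lambda(x))F_{i+1}^k$ for $i2^{-k}\le x\le(i+1)2^{-k}$, with $\lambda(x)=(i+1)-x2^k$. *)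

(* Defs.v *)
From HB Require Import structures.
From mathcomp Require Import all_boot all_order all_algebra.
From mathcomp Require Import all_classical all_reals.
From mathcomp Require Import ereal topology normedtype sequences.
Set Implicit Arguments. Unset Strict Implicit. Unset Printing Implicit Defensive.
Import Order.TTheory GRing.Theory Num.Theory.
Import numFieldNormedType.Exports.
Local Open Scope classical_set_scope.
Local Open Scope ring_scope.

Section SetAverages.
Variables (R : realType) (n : nat).
Local Notation V := 'rV[R]_n.

Definition enorm (p : V) : R := Num.sqrt (\sum_(i < n) (p ord0 i) ^+ 2).

(* d(q,E) = min_{e in E} ||q - e|| (the infimum; it is attained for closed E) *)
Definition dist (q : V) (E : set V) : R := inf [set enorm (q - e) | e in E].

Definition bounded_set_e (A : set V) : Prop :=
  exists M : R, forall p, A p -> enorm p <= M.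

Definition ci (E : set V) : set V := closure (interior E).
Definition bnd (E : set V) : set V := closure E `\` interior E.

Definition box (a b : V) : set V :=
  [set p | forall i : 'I_n, a ord0 i <= p ord0 i <= b ord0 i].
Definition vol (a b : V) : R := \prod_(i < n) Num.max (b ord0 i - a ord0 i) 0.

Definition lebo (A : set V) : \bar R :=
  ereal_inf [set s | exists a b : nat -> V,
     A `<=` \bigcup_k box (a k) (b k) /\
     s = (\sum_(0 <= k <oo) ((vol (a k) (b k))%:E))%E].

(* real-valued measure (used on sets of finite measure) *)
Definition mu (A : set V) : R := fine (lebo A).

Definition lmeasurable (E : set V) : Prop :=
  forall X : set V, lebo X = (lebo (X `&` E) + lebo (X `&` ~` E))%E.

Definition inL (E : set V) : Prop := lmeasurable E /\ (lebo E < +oo)%E.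

Definition inJ (A : set V) : Prop :=
  bounded_set_e A /\ A = ci A /\ lebo (bnd A) = 0%E.

Definition dmu (A B : set V) : \bar R := lebo ((A `\` B) `|` (B `\` A)).

Definition dS (A : set V) (p : V) : R :=
  if pselect (A p) then dist p (bnd A) else - dist p (bnd A).

(* qsel A : the fixed point q of A maximizing d_S(., A) over A *)
Definition davgfun (qsel : set V -> V) (A B : set V) (x : R) (p : V) : R :=
  if pselect (B = set0) then x * dS A p + (x - 1) * enorm (p - qsel A)
  else x * dS A p + (1 - x) * dS B p.

Definition davg (qsel : set V -> V) (A B : set V) (x : R) : set V :=
  if pselect (A = set0) then set0
  else [set p | 0 <= davgfun qsel A B x p].

Definition h (qsel : set V -> V) (A B : set V) (x : R) : R := mu (davg qsel A B x).

Definition zmc (A B : set V) : Prop :=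
  lebo [set p | 2^-1 * dS A p + 2^-1 * dS B p = 0] = 0%E.

Definition Oball (B : set V) (r : R) : set V := [set p | dist p B <= r].

Definition avg1 (N : R) (qsel : set V -> V) (A B : set V) (t : R) : set V :=
  let target := t * mu A + (1 - t) * mu B in
  if pselect (A = B) then A else
  if pselect (B = set0 \/ zmc A B \/ ~ (0 <= t <= 1)) then
    let g := xget 0 [set g : R | -N <= g <= N /\
               forall xi, -N <= xi <= N ->
                 `|h qsel A B g - target| <= `|h qsel A B xi - target|] in
    ci (davg qsel A B g)
  else
    let r := xget 0 [set r : R | 0 <= r /\ mu (Oball B r `&` A) = target] in
    ci (Oball B r `&` A).

Definition components (E : set V) : set (set V) :=
  [set connected_component E x | x in E].

Definition comps (eps : R) (A B : set V) : set (set V) :=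
  let Cs := components (A `\` B) in
  if pselect (finite_set Cs) then Cs
  else [set C | Cs C /\ (eps%:E <= lebo C)%E] `|`
       [set \bigcup_(C in [set C | Cs C /\ (lebo C < eps%:E)%E]) C].

Definition avg2 (N eps : R) (qsel : set V -> V) (A B : set V) (t : R) : set V :=
  if pselect (A = B) then A else
  if pselect (0 <= t) then
    \bigcup_(C in comps eps A B) avg1 N qsel (B `|` C) B t
  else ci (\bigcap_(C in comps eps A B) avg1 N qsel (B `|` C) B t).

Definition mavg (N eps : R) (qsel : set V -> V) (A B : set V) (t : R) : set V :=
  if pselect (A = B) then A else
  let I := ci (A `&` B) in
  if pselect (0 <= t <= 1) then
    avg2 N eps qsel A I t `|` avg2 N eps qsel B I (1 - t)
  else if pselect (1 < t) then
    ci (avg2 N eps qsel A I t `\` (A `&` B)) `|` avg2 N eps qsel B I (1 - t)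
  else (* t < 0 : (1-t) B (+) t A by the t > 1 rule with A, B exchanged *)
    ci (avg2 N eps qsel B I (1 - t) `\` (B `&` A)) `|` avg2 N eps qsel A I t.

Definition spline_step (N eps : R) (qsel : set V -> V) (m : nat)
    (F : int -> set V) : int -> set V :=
  let F0 := fun i : int =>
    if i \in dvdz 2 then F (divz i 2)
    else mavg N eps qsel (F (divz i 2)) (F (divz i 2 + 1)) (2^-1) in
  let Fm := iter m.-1
    (fun G : int -> set V => fun i => mavg N eps qsel (G i) (G (i + 1)) (2^-1)) F0 in
  fun i => Fm (i - ((m.-1)./2)%:Z).

Definition spline_level (N eps : R) (qsel : set V -> V) (m : nat)
    (F : int -> set V) (k : nat) : int -> set V :=
  iter k (spline_step N eps qsel m) F.

Definition interpolant (N eps : R) (qsel : set V -> V) (m : nat)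
    (F : int -> set V) (k : nat) (x : R) : set V :=
  let Fk := spline_level N eps qsel m F k in
  let i := Num.floor (x * 2 ^+ k) in
  mavg N eps qsel (Fk i) (Fk (i + 1)) (i%:~R + 1 - x * 2 ^+ k).

End SetAverages.

(* Main.v *)
(** For [t] in [0, 1] the measure average [M] of [A] and [B] is regular closed with null
    boundary and lies metrically between them: d(M, A) <= (1 - t) d(A, B) and
    d(M, B) <= t d(A, B). Hence one refinement halves the distance of neighbours,
    smoothing does not increase it, and a set moves by at most m times this distance.
    So consecutive interpolants differ by O(L 2^-k) uniformly, they are L-Lipschitz up to
    an error O(L 2^-k), and the lower limit of the interpolants is the limit in measure.

    Betweenness of a nested average reduces to finding a member of prescribed measure in an
    increasing family of level sets {f_x >= 0}, which exists as soon as the zero sets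
    {f_x = 0} are null. These zero sets are porous: moving from a zero towards the nearest
    boundary point changes one of the two signed distances at unit rate and the other at
    most at unit rate, while their weights differ. Porous sets are null by a covering
    argument on cubes, so neither Rademacher's nor Lebesgue's theorem is needed. *)
Require Import Defs.
From HB Require Import structures.
From mathcomp Require Import all_boot all_order all_algebra.
From mathcomp Require Import all_classical all_reals.
From mathcomp Require Import ereal topology normedtype sequences.
From mathcomp Require Import esum measure derive ring lra zify.
Set Implicit Arguments. Unset Strict Implicit. Unset Printing Implicit Defensive.
Import Order.TTheory GRing.Theory Num.Theory.
Import numFieldNormedType.Exports.
Local Open Scope classical_set_scope.
Local Open Scope ring_scope.

(** The weight 1/2 shapes the proof: there the two signed distances may cancel on a set of positive
    measure, so the measure of the distance average can jump past its target. Three devices cover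
    this weight: the zero-measure condition itself, neighbourhoods of B when that condition fails,
    and, for empty B, a separate argument that the points of A equidistant from the boundary and
    from the deepest point q form a null set. At every other weight porosity suffices.

    Two further obstacles fix the form of the statements. The minimizer g is arbitrary and may lie
    outside [0, 1], so inclusions between averages hold only up to null sets. And B joined with some
    components of A \ B need not be regular closed; what survives for every union of components is
    boundedness and a null boundary, and these are the hypotheses on the larger set in Step 1.

    Completeness of the space of measurable sets is replaced by an explicit limit: the symmetric
    differences of consecutive interpolants have summable measures, so almost every point changes
    membership only finitely often. *)

Section LebesgueOuter.
Variables (R : realType) (n' : nat).
Local Notation n := n'.+1.
Local Notation V := 'rV[R]_n.
Local Notation lebo := (@lebo R n).
Implicit Types (a b p q : V) (A B E X : set V).

(** * Lebesgue outer measure and measurability of open sets *)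

Lemma vol_ge0 a b : 0 <= vol a b.
Proof. by apply: prodr_ge0 => i _; rewrite le_max lexx orbT. Qed.

Lemma vol_eseries_ge0 (a b : nat -> V) :
  (0 <= \sum_(0 <= k <oo) (vol (a k) (b k))%:E)%E.
Proof. by apply: nneseries_ge0 => k _ _; rewrite lee_fin vol_ge0. Qed.

Lemma lebo_ge0 A : (0 <= lebo A)%E.
Proof. by apply: le_ereal_inf_tmp => _ [a [b [_ ->]]]; exact: vol_eseries_ge0. Qed.

Lemma le_lebo A B : A `<=` B -> (lebo A <= lebo B)%E.
Proof.
move=> AB; apply: ereal_inf_le_tmp => s [a [b [Bab ->]]].
by exists a, b; split => //; exact: subset_trans AB Bab.
Qed.

(** Covers in [lebo] are infinite sequences, so finite covers are padded with this empty box of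
    volume zero. It needs at least one coordinate, hence the dimension [n'.+1]. *)
Lemma vol_empty : vol (const_mx 1) (0 : V) = 0.
Proof.
rewrite /vol (bigD1 ord0)//= !mxE sub0r.
by rewrite (_ : Num.max _ _ = 0) ?mul0r//; apply/max_idPr; rewrite lerN10.
Qed.

Lemma lebo_box_le a b : (lebo (box a b) <= (vol a b)%:E)%E.
Proof.
apply: ereal_inf_lbound.
exists (fun k => if k == 0%N then a else const_mx 1),
  (fun k => if k == 0%N then b else 0); split.
  by move=> p ab; exists 0%N.
rewrite nneseries_recl//; last by move=> k _; rewrite lee_fin vol_ge0.
rewrite eseries_cond/= eseries0 ?adde0// => -[|k]//= _ _.
by rewrite vol_empty.
Qed.

Lemma lebo0 : lebo set0 = 0%E.
Proof.
apply/eqP; rewrite eq_le lebo_ge0 andbT.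
have := lebo_box_le (const_mx 1) 0; rewrite vol_empty; apply: le_trans.
exact: le_lebo.
Qed.

Lemma lebo_sigma_subadditive : sigma_subadditive lebo.
Proof.
move=> A; have [[i ioo]|] := pselect (exists i, lebo (A i) = +oo%E).
  rewrite (eseries_pinfty _ _ ioo) ?leey// => k _.
  by rewrite -ltNye (lt_le_trans _ (lebo_ge0 _)).
rewrite -forallNE => Aoo; apply/lee_addgt0Pr => _/posnumP[e].
rewrite (le_trans _ (epsilon_trick _ _ _))//; last first.
  by move=> k; exact: lebo_ge0.
pose P k (B : nat -> V * V) := A k `<=` \bigcup_j box (B j).1 (B j).2 /\
  (\sum_(0 <= j <oo) (vol (B j).1 (B j).2)%:E <=
     lebo (A k) + (e%:num / (2 ^ k.+1)%:R)%:E)%E.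
have [G PG] : {G : nat -> nat -> V * V & forall k, P k (G k)}.
  apply: (@choice _ _ P) => k.
  have fA : lebo (A k) \is a fin_num.
    by rewrite ge0_fin_numE ?lebo_ge0// ltey; exact/eqP/Aoo.
  have en1 : 0 < e%:num / (2 ^ k.+1)%:R :> R by [].
  have [x [a [b [Aab ->]]] xS] := lb_ereal_inf_adherent en1 fA.
  by exists (fun j => (a j, b j)); split => //=; exact: ltW.
pose v (i : nat * nat) := (vol (G i.1 i.2).1 (G i.1 i.2).2)%:E.
have v0 i : (0 <= v i)%E by rewrite lee_fin vol_ge0.
apply: (@le_trans _ _ (\esum_(i in setT) v i)%E).
  apply: ereal_inf_lbound => /=.
  have /card_esym/ppcard_eqP[f] := card_nat2.
  exists (fun k => (G (f k).1 (f k).2).1), (fun k => (G (f k).1 (f k).2).2); split.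
    move=> t [i _ /(PG i).1[j _ ?]]; exists (f^-1%FUN (i, j)) => //=.
    by rewrite invK ?inE.
  rewrite -[RHS](esum_pred_image v f xpredT) ?[fun=> _]set_true//.
  congr (esum _ v); apply/seteqP; split=> // i _.
  by exists (f^-1%FUN i); rewrite ?invK ?inE.
have -> : esum setT v = (\sum_(i <oo) \sum_(j <oo) v (i, j))%E.
  rewrite nneseries_esumT; last by move=> k; exact: nneseries_ge0.
  rewrite (eq_esum (b := fun i => (\esum_(j in setT) v (i, j))%E)); last first.
    by move=> i _; rewrite nneseries_esumT.
  rewrite (esum_esum (J := fun=> setT) (a := fun i j => v (i, j)))//.
  rewrite (_ : _ `*`` _ = setT); last by apply/seteqP; split.
  by apply: eq_esum => -[].
apply: lee_lim.
- by apply: is_cvg_nneseries => k *; exact: nneseries_ge0.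
- apply: is_cvg_nneseries => k *; apply: adde_ge0; first exact: lebo_ge0.
  by rewrite lee_fin.
- by apply: nearW => k; apply: lee_sum => i _; exact: (PG i).2.
Qed.

(** With this instance [lmeasurable] is convertible to Caratheodory measurability, which brings the
    closure properties under countable operations. *)
HB.instance Definition _ := isOuterMeasure.Build R V lebo
  lebo0 lebo_ge0 le_lebo lebo_sigma_subadditive.

Definition upd (p : V) (i : 'I_n) (x : R) : V :=
  \row_j (if j == i then x else p ord0 j).

Lemma updE p i x j : upd p i x ord0 j = if j == i then x else p ord0 j.
Proof. by rewrite mxE. Qed.

(** If c lies outside the i-th side, one of the two pieces is degenerate and the truncation at 0 in
    [vol] gives it volume 0. Cutting every box of a cover in this way makes half-spaces
    measurable. *)
Lemma vol_split a b i c :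
  vol a b = vol a (upd b i (Num.min (b ord0 i) c)) +
            vol (upd a i (Num.max (a ord0 i) c)) b.
Proof.
rewrite /vol (bigD1 i)//= [X in _ = X + _](bigD1 i)//= [X in _ = _ + X](bigD1 i)//=.
rewrite !updE eqxx.
rewrite [X in _ = _ * X + _](eq_bigr (fun i => Num.max (b ord0 i - a ord0 i) 0)); last first.
  by move=> j /negbTE ji; rewrite updE ji.
rewrite [X in _ = _ + _ * X](eq_bigr (fun i => Num.max (b ord0 i - a ord0 i) 0)); last first.
  by move=> j /negbTE ji; rewrite updE ji.
rewrite -mulrDl; congr (_ * _).
set x := a _ _; set y := b _ _.
rewrite /Num.max /Num.min; repeat case: ifPn; rewrite -?leNgt; lra.
Qed.

Lemma halfspace_lmeasurable i c : lmeasurable [set p : V | p ord0 i <= c].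
Proof.
apply: (@le_caratheodory_measurable R V lebo) => X.
apply: le_ereal_inf_tmp => _ [a [b [Xab ->]]].
under eq_eseriesr do rewrite (vol_split _ _ i c) EFinD.
rewrite nneseriesD; try by move=> *; rewrite lee_fin vol_ge0.
apply: leeD; apply: ereal_inf_lbound.
- exists a, (fun k => upd (b k) i (Num.min (b k ord0 i) c)); split=> //.
  move=> p [Xp pc]; have [k _ abp] := Xab p Xp; exists k => // j.
  have := abp j; rewrite updE; case: eqP => [->|//] /andP[-> /= pb].
  by rewrite le_min pb.
- exists (fun k => upd (a k) i (Num.max (a k ord0 i) c)), b; split=> //.
  move=> p [Xp /negP]; rewrite -ltNge => pc.
  have [k _ abp] := Xab p Xp; exists k => // j.
  have := abp j; rewrite updE; case: eqP => [->|//] /andP[pb ->].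
  by rewrite ge_max pb ltW.
Qed.


Lemma nbhs_coordP p A : nbhs p A <->
  exists2 e : R, 0 < e & forall q, (forall i, `|p ord0 i - q ord0 i| < e) -> A q.
Proof.
split=> [/nbhs_ballP[e /= e0 eA]|[e e0 eA]].
  by exists e => // q pq; apply: eA; split=> // i j; rewrite (ord1 i); exact: pq.
by apply/nbhs_ballP; exists e => //= q [_ pq]; apply: eA => i; exact: pq.
Qed.

Lemma box_lmeasurable a b : lmeasurable (box a b).
Proof.
have mI (P : 'I_n -> set V) : (forall i, lmeasurable (P i)) ->
    lmeasurable [set p | forall i, P i p].
  move=> mP.
  (* A finite intersection becomes the complement of a union over [nat]; [insub] puts empty sets at
     the indices that are not below n. *)
  have -> : [set p | forall i, P i p] =
      ~` \bigcup_k (if insub k is Some i then ~` P i else set0).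
    apply/seteqP; split=> [p Pp [k _]|p NP i].
      by case: insubP => [i _ _|//]; apply; exact: Pp.
    apply: contrapT => Pip; apply: NP; exists (val i) => //.
    by rewrite valK.
  apply: caratheodory_measurable_setC.
  apply: caratheodory_measurable_bigcup => k; case: insubP => [i _ _|_].
    by apply: caratheodory_measurable_setC; exact: mP.
  exact: caratheodory_measurable_set0.
have mlt i c : lmeasurable [set p : V | p ord0 i < c].
  have -> : [set p : V | p ord0 i < c] =
      \bigcup_k [set p : V | p ord0 i <= c - k.+1%:R^-1].
    apply/seteqP; split=> [p /= pc|p [k _ /= pk]].
      have := pc; rewrite -subr_gt0 => /ltr_add_invr[k].
      by rewrite add0r => kc; exists k => //=; rewrite lerBrDl -lerBrDr ltW.
    by apply: le_lt_trans pk _; rewrite ltrBlDr ltrDl.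
  by apply: caratheodory_measurable_bigcup => k; exact: halfspace_lmeasurable.
apply: mI => i.
have -> : (fun p : V => is_true (a ord0 i <= p ord0 i <= b ord0 i)) =
    [set p : V | p ord0 i <= b ord0 i] `\` [set p : V | p ord0 i < a ord0 i].
  apply/seteqP; split=> p /=; first by move=> /andP[ap ->]; split=> //; rewrite ltNge ap.
  by move=> [-> /negP]; rewrite -leNgt => ->.
by apply: caratheodory_measurable_setD; [exact: halfspace_lmeasurable|exact: mlt].
Qed.

Lemma open_lmeasurable (U : set V) : open U -> lmeasurable U.
Proof.
move=> oU.
pose rb (c : 'rV[rat]_n * 'rV[rat]_n) : set V :=
  box (map_mx ratr c.1) (map_mx ratr c.2).
(* U is the union of the boxes with rational corners that it contains, enumerated by [unpickle]. *)
have -> : U = \bigcup_k (if @unpickle ('rV[rat]_n * 'rV[rat]_n)%type k is Some c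
    then (if pselect (rb c `<=` U) then rb c else set0) else set0).
  apply/seteqP; split=> [p Up|p [k _]]; last first.
    by case: unpickle => // c; case: pselect => // cU; exact: cU.
  have /nbhs_coordP[e e0 eU] := open_nbhs_nbhs (conj oU Up).
  have H1 i : exists q : rat, p ord0 i - e < ratr q < p ord0 i.
    have /rat_in_itvoo[q] : p ord0 i - e < p ord0 i by rewrite ltrBlDr ltrDl.
    by rewrite in_itv/= => qP; exists q.
  have H2 i : exists q : rat, p ord0 i < ratr q < p ord0 i + e.
    have /rat_in_itvoo[q] : p ord0 i < p ord0 i + e by rewrite ltrDl.
    by rewrite in_itv/= => qP; exists q.
  have [q1 q1P] := choice H1; have [q2 q2P] := choice H2.
  exists (pickle (\row_i q1 i, \row_i q2 i)) => //; rewrite pickleK.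
  have cU : rb (\row_i q1 i, \row_i q2 i) `<=` U.
    move=> q qb; apply: eU => i; have := qb i; rewrite !mxE => /andP[].
    have /andP[] := q1P i; have /andP[] := q2P i.
    rewrite ltr_norml; lra.
  case: pselect => // ? i; rewrite !mxE; have /andP[_ /ltW ->] := q1P i.
  by have /andP[/ltW ->] := q2P i.
apply: caratheodory_measurable_bigcup => k.
case: unpickle => [c|]; last exact: caratheodory_measurable_set0.
case: pselect => ?; [exact: box_lmeasurable|exact: caratheodory_measurable_set0].
Qed.
End LebesgueOuter.

(** * Euclidean norm, distance to a set and signed distance *)

Section Euclid.
Variables (R : realType) (n' : nat).
Local Notation n := n'.+1.
Local Notation V := 'rV[R]_n.
Implicit Types (p q u v w : V) (A B E : set V).

Definition dot u v : R := \sum_(i < n) u ord0 i * v ord0 i.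

Lemma enorm_ge0 p : 0 <= enorm p. Proof. exact: sqrtr_ge0. Qed.

Lemma enorm_sqr p : enorm p ^+ 2 = dot p p.
Proof.
rewrite sqr_sqrtr; last by apply: sumr_ge0 => i _; exact: sqr_ge0.
by apply: eq_bigr => i _; rewrite expr2.
Qed.

Lemma dotC u v : dot u v = dot v u.
Proof. by apply: eq_bigr => i _; rewrite mulrC. Qed.

Lemma dotDl u v w : dot (u + v) w = dot u w + dot v w.
Proof. by rewrite -big_split/=; apply: eq_bigr => i _; rewrite mxE mulrDl. Qed.

Lemma dotZl c u v : dot (c *: u) v = c * dot u v.
Proof. by rewrite mulr_sumr; apply: eq_bigr => i _; rewrite mxE mulrA. Qed.

Lemma dotDr u v w : dot w (u + v) = dot w u + dot w v.
Proof. by rewrite dotC dotDl !(dotC w). Qed.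

Lemma dotZr c u v : dot u (c *: v) = c * dot u v.
Proof. by rewrite dotC dotZl dotC. Qed.

Lemma enorm_sqrD u v : enorm (u + v) ^+ 2 = enorm u ^+ 2 + 2 * dot u v + enorm v ^+ 2.
Proof. rewrite !enorm_sqr dotDl !dotDr (dotC v u); ring. Qed.

Lemma coord_le_enorm p i : `|p ord0 i| <= enorm p.
Proof.
rewrite -(ler_pXn2r (ltn0Sn 1)) ?nnegrE ?enorm_ge0//.
rewrite enorm_sqr real_normK ?num_real// /dot (bigD1 i)//= -expr2 lerDl.
by apply: sumr_ge0 => j _; rewrite -expr2 sqr_ge0.
Qed.

Lemma enorm_le_coord p (e : R) : (forall i, `|p ord0 i| <= e) -> enorm p <= n%:R * e.
Proof.
move=> pe; have e0 : 0 <= e by apply: le_trans (pe ord0).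
rewrite -(ler_pXn2r (ltn0Sn 1)) ?nnegrE ?enorm_ge0 ?mulr_ge0//.
rewrite enorm_sqr; apply: (@le_trans _ _ (\sum_(i < n) e ^+ 2)).
  apply: ler_sum => i _; rewrite -expr2 -[leLHS]real_normK ?num_real//.
  by rewrite lerXn2r ?nnegrE.
rewrite sumr_const card_ord -(mulr_natl (e ^+ 2)) exprMn ler_wpM2r ?sqr_ge0//.
by rewrite expr2 ler_peMr// ler1n.
Qed.

Lemma enorm0 : enorm (0 : V) = 0.
Proof. by rewrite /enorm big1 ?sqrtr0// => i _; rewrite mxE expr0n. Qed.

Lemma enormZ c p : enorm (c *: p) = `|c| * enorm p.
Proof.
rewrite /enorm -sqrtr_sqr -sqrtrM ?sqr_ge0// mulr_sumr; congr Num.sqrt.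
by apply: eq_bigr => i _; rewrite mxE exprMn.
Qed.

Lemma enormN p : enorm (- p) = enorm p.
Proof. by rewrite -scaleN1r enormZ normrN1 mul1r. Qed.

Lemma enormB p q : enorm (p - q) = enorm (q - p).
Proof. by rewrite -enormN opprB. Qed.

Lemma enorm_eq0 p : enorm p = 0 -> p = 0.
Proof.
move=> p0; apply/rowP => i; rewrite mxE; apply/eqP.
by rewrite -normr_le0 -p0 coord_le_enorm.
Qed.

Lemma cauchy_schwarz u v : dot u v <= enorm u * enorm v.
Proof.
have [v0|v0] := eqVneq (enorm v) 0.
  by rewrite v0 mulr0 (enorm_eq0 v0) -(scale0r 0) dotZr mul0r.
have {}v0 : 0 < enorm v by rewrite lt_neqAle eq_sym v0 enorm_ge0.
have := sqr_ge0 (enorm ((enorm v ^+ 2) *: u + (- dot u v) *: v)).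
rewrite enorm_sqrD !enormZ dotZl dotZr !exprMn !real_normK ?num_real//.
set a := enorm u; set b := enorm v; set d := dot u v => H.
have {H} : 0 <= b ^+ 2 * ((a * b) ^+ 2 - d ^+ 2) by lra.
rewrite pmulr_rge0 ?exprn_gt0// subr_ge0 => H.
apply: le_trans (ler_norm _) _.
rewrite -(ler_pXn2r (ltn0Sn 1)) ?nnegrE ?mulr_ge0 ?enorm_ge0//.
by rewrite real_normK ?num_real.
Qed.

Lemma enormD u v : enorm (u + v) <= enorm u + enorm v.
Proof.
rewrite -(ler_pXn2r (ltn0Sn 1)) ?nnegrE ?addr_ge0 ?enorm_ge0//.
rewrite enorm_sqrD sqrrD; have := cauchy_schwarz u v; lra.
Qed.

Lemma enorm_triangle p q w : enorm (p - w) <= enorm (p - q) + enorm (q - w).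
Proof. by apply: le_trans (enormD _ _); rewrite addrA subrK. Qed.

Lemma nbhs_enormP p A : nbhs p A <->
  exists2 e : R, 0 < e & forall q, enorm (p - q) < e -> A q.
Proof.
split=> [/nbhs_coordP[e e0 eA]|[e e0 eA]].
  exists e => // q pq; apply: eA => i; apply: le_lt_trans pq.
  by have := coord_le_enorm (p - q) i; rewrite !mxE.
apply/nbhs_coordP; exists (e / n.+1%:R); first by rewrite divr_gt0.
move=> q pq; apply: eA; apply: (@le_lt_trans _ _ (n%:R * (e / n.+1%:R))).
  by apply: enorm_le_coord => i; rewrite !mxE ltW.
by rewrite mulrCA gtr_pMr// ltr_pdivrMr// mul1r ltr_nat.
Qed.

Lemma interior_enormP A p : interior A p <->
  exists2 e : R, 0 < e & forall q, enorm (p - q) < e -> A q.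
Proof. exact: nbhs_enormP. Qed.

Lemma closure_enormP A p : closure A p <->
  forall e : R, 0 < e -> exists2 q, A q & enorm (p - q) < e.
Proof.
split=> [clA e e0|H B /nbhs_enormP[e e0 eB]].
  have [|q [Aq pq]] := clA [set q | enorm (p - q) < e].
    by apply/nbhs_enormP; exists e.
  by exists q.
by have [q Aq pq] := H e e0; exists q; split=> //; exact: eB.
Qed.

Definition segpt p q (t : R) : V := p + t *: (q - p).

Lemma segpt_continuous p q : continuous (segpt p q).
Proof. by move=> t; apply: cvgD; [exact: cvg_cst|apply: cvgZr_tmp; exact: cvg_id]. Qed.

Definition segment p q : set V := segpt p q @` `[0, 1].

Lemma segment_connected p q : connected (segment p q).
Proof.
apply: connected_continuous_connected; first exact: segment_connected.
exact: continuous_subspaceT (@segpt_continuous p q).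
Qed.

Lemma segment0 p q : segment p q p.
Proof. by exists 0; rewrite /= ?in_itv/= ?lexx ?ler01// /segpt scale0r addr0. Qed.

Lemma segment1 p q : segment p q q.
Proof. by exists 1; rewrite /= ?in_itv/= ?lexx ?ler01// /segpt scale1r addrC subrK. Qed.

Lemma segmentP p q z : segment p q z ->
  enorm (p - z) + enorm (z - q) = enorm (p - q).
Proof.
move=> [t]; rewrite /= in_itv/= => /andP[t0 t1] <-; rewrite /segpt.
rewrite opprD addrA subrr sub0r -scalerN opprB enormZ ger0_norm//.
rewrite (_ : p + t *: (q - p) - q = (1 - t) *: (p - q)); last first.
  by rewrite scalerBl scale1r -(opprB p q) scalerN addrAC.
by rewrite enormZ ger0_norm ?subr_ge0// -mulrDl addrC subrK mul1r.
Qed.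

Lemma closed_bnd A : closed (bnd A).
Proof.
by rewrite /bnd setDE; apply: closedI; [exact: closed_closure|
  exact/open_closedC/open_interior].
Qed.

(** Without a boundary point on the segment, the interior of A would be both open and closed
    relative to the segment, and connectedness would put q in A. *)
Lemma crossing A p q : A p -> ~ A q ->
  exists z, bnd A z /\ enorm (p - z) + enorm (z - q) = enorm (p - q).
Proof.
move=> Ap Aq; apply: contrapT => H.
have N z : segment p q z -> ~ bnd A z.
  by move=> /segmentP sz bz; apply: H; exists z.
apply: Aq; apply: (@interior_subset _ A).
suff E : segment p q `&` interior A = segment p q.
  by have := segment1 p q; rewrite -E => -[].
apply: (@segment_connected p q).
- exists p; split; first exact: segment0.
  apply: contrapT => iAp; apply: (N p); first exact: segment0.
  by split=> //; exact: subset_closure.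
- by exists (interior A) => //; exact: open_interior.
- exists (closure A); first exact: closed_closure.
  apply/seteqP; split=> z [sz Az]; split=> //.
    by apply: subset_closure; exact: interior_subset.
  by apply: contrapT => iAz; apply: (N z).
Qed.

Lemma bounded_compl A : bounded_set_e A -> exists p, ~ A p.
Proof.
move=> [M AM]; exists (const_mx (`|M| + 1)) => /AM H.
have := coord_le_enorm (const_mx (`|M| + 1)) ord0; rewrite mxE => /le_trans /(_ H).
have := ler_norm M; have := ler_norm (`|M| + 1); lra.
Qed.

Lemma bnd_neq0 A : bounded_set_e A -> A !=set0 -> bnd A !=set0.
Proof.
move=> /bounded_compl[q Aq] [p Ap].
by have [z [Az _]] := crossing Ap Aq; exists z.
Qed.

Lemma closure_enorm_le A M : (forall p, A p -> enorm p <= M) ->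
  forall p, closure A p -> enorm p <= M.
Proof.
move=> AM p /closure_enormP clAp; apply/ler_addgt0Pr => e e0.
have [q Aq pq] := clAp e e0; have := enormD (p - q) q; rewrite subrK.
by move=> /le_trans; apply; rewrite addrC lerD ?AM ?ltW.
Qed.

Lemma dist_has_inf q E : E !=set0 -> has_inf [set enorm (q - e) | e in E].
Proof.
move=> [e Ee]; split; first by exists (enorm (q - e)); exists e.
by exists 0 => _ [f _ <-]; exact: enorm_ge0.
Qed.

Lemma dist_le q E e : E e -> dist q E <= enorm (q - e).
Proof.
move=> Ee; apply: ge_inf; last by exists e.
by exists 0 => _ [f _ <-]; exact: enorm_ge0.
Qed.

Lemma dist_ge q E c : E !=set0 -> (forall e, E e -> c <= enorm (q - e)) ->
  c <= dist q E.
Proof.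
move=> [e Ee] cE; apply: lb_le_inf; first by exists (enorm (q - e)); exists e.
by move=> _ [f Ef <-]; exact: cE.
Qed.

Lemma dist_approx q E d : E !=set0 -> 0 < d ->
  exists2 e, E e & enorm (q - e) < dist q E + d.
Proof.
move=> E0 d0; have [_ [e Ee <-] qe] := inf_adherent d0 (dist_has_inf q E0).
by exists e.
Qed.

Lemma dist_ge0 q E : 0 <= dist q E.
Proof.
have [->|/set0P E0] := eqVneq E set0; first by rewrite /dist image_set0 inf0.
by apply: dist_ge => // e _; exact: enorm_ge0.
Qed.

Lemma dist_in q E : E q -> dist q E = 0.
Proof.
move=> Eq; apply/eqP; rewrite eq_le dist_ge0 andbT.
by rewrite -[leRHS]enorm0 -(subrr q) dist_le.
Qed.

Lemma dist1 p q : dist p [set q] = enorm (p - q).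
Proof.
apply/eqP; rewrite eq_le dist_le//=; apply: dist_ge; first by exists q.
by move=> _ ->.
Qed.

Lemma dist_lip p q E : `|dist p E - dist q E| <= enorm (p - q).
Proof.
have [->|/set0P E0] := eqVneq E set0.
  by rewrite /dist !image_set0 subrr normr0 enorm_ge0.
have H u v : dist u E - enorm (u - v) <= dist v E.
  apply: dist_ge => // e Ee; have := dist_le u Ee; have := enorm_triangle u v e; lra.
by rewrite ler_norml; have := H p q; have := H q p; rewrite (enormB q p); lra.
Qed.

Lemma dist_eq0 q E : closed E -> E !=set0 -> dist q E = 0 -> E q.
Proof.
move=> cE E0 qE; rewrite (closure_id E).1//; apply/closure_enormP => e e0.
by have [f Ef] := dist_approx q E0 e0; rewrite qE add0r; exists f.
Qed.

Lemma dS_in A p : A p -> dS A p = dist p (bnd A).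
Proof. by rewrite /dS; case: pselect. Qed.

Lemma dS_out A p : ~ A p -> dS A p = - dist p (bnd A).
Proof. by rewrite /dS; case: pselect. Qed.

Lemma dS_norm A p : `|dS A p| = dist p (bnd A).
Proof.
case: (pselect (A p)) => Ap; first by rewrite dS_in// ger0_norm// dist_ge0.
by rewrite dS_out// normrN ger0_norm// dist_ge0.
Qed.

(** The case beyond [dist_lip] is p in A and q outside: a boundary point cuts the segment into two
    pieces whose lengths bound the two distances, and here these distances add up. *)
Lemma dS_lip A p q : `|dS A p - dS A q| <= enorm (p - q).
Proof.
wlog Ap : p q / A p.
  move=> H; case: (pselect (A p)) => Ap; first exact: H.
  case: (pselect (A q)) => Aq; first by rewrite distrC enormB; exact: H.
  by rewrite !dS_out//; have := dist_lip p q (bnd A); rewrite !ler_norml; lra.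
rewrite (dS_in Ap); case: (pselect (A q)) => Aq; first by rewrite dS_in// dist_lip.
rewrite dS_out// opprK ger0_norm ?addr_ge0 ?dist_ge0//.
have [z [bz <-]] := crossing Ap Aq; rewrite lerD ?dist_le// enormB.
exact: dist_le.
Qed.

(** For p in B, a boundary point of A is a boundary point of B or lies outside B, and in the latter
    case the segment from p to it crosses the boundary of B. Outside A the roles are exchanged. This
    makes the distance average increase with its weight. *)
Lemma dS_mono A B p : B `<=` A -> bnd A !=set0 -> bnd B !=set0 ->
  dS B p <= dS A p.
Proof.
move=> BA A0 B0; case: (pselect (B p)) => Bp.
  rewrite !dS_in//; last exact: BA.
  apply: dist_ge => // z [clAz iAz]; case: (pselect (bnd B z)) => bz.
    exact: dist_le.
  have [//|Bz|w [bw <-]] := @crossing B p z.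
    apply: bz; split; first exact: subset_closure.
    by move=> iBz; apply: iAz; exact: (interiorS BA).
  by apply: (le_trans (dist_le p bw)); rewrite lerDl enorm_ge0.
case: (pselect (A p)) => Ap.
  rewrite dS_out// dS_in//; apply: (@le_trans _ _ 0); rewrite ?oppr_le0 ?dist_ge0//.
rewrite !dS_out// lerN2; apply: dist_ge => // z [clBz iBz].
have clAz : closure A z by exact: (closureS BA).
case: (pselect (bnd A z)) => bz; first exact: dist_le.
have Az : A z.
  by apply: contrapT => Az; apply: bz; split=> // /interior_subset.
have [w [bw]] := crossing Az Ap; rewrite (enormB p z) => <-.
by apply: (le_trans (dist_le p bw)); rewrite (enormB p w) lerDr enorm_ge0.
Qed.

Lemma dS_ge0 A p : bnd A !=set0 -> 0 <= dS A p -> closure A p.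
Proof.
move=> A0; case: (pselect (A p)) => Ap; first by move=> _; exact: subset_closure.
rewrite dS_out// oppr_ge0 => d0.
have [] // : bnd A p; apply: dist_eq0 => //; first exact: closed_bnd.
by apply/eqP; rewrite eq_le d0 dist_ge0.
Qed.

Lemma dS_in_ge0 A p : A p -> 0 <= dS A p.
Proof. by move=> Ap; rewrite dS_in// dist_ge0. Qed.

Lemma dS_eq0 A p : bnd A !=set0 -> dS A p = 0 -> bnd A p.
Proof.
move=> A0 d0; apply: dist_eq0 => //; first exact: closed_bnd.
by rewrite -dS_norm d0 normr0.
Qed.

(** Far out every signed distance is - |p| up to M, so the difference of two of them stays bounded.
    Hence distance averages are bounded for every real weight. *)
Lemma dS_far A M p : (forall q, A q -> enorm q <= M) -> bnd A !=set0 -> M < enorm p ->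
  - enorm p - M <= dS A p <= M - enorm p.
Proof.
move=> AM A0 Mp; have Ap : ~ A p by move=> /AM; rewrite leNgt Mp.
have bM q : bnd A q -> enorm q <= M by move=> [/(closure_enorm_le AM)].
rewrite dS_out//; apply/andP; split.
  have [q bq] := A0; rewrite lerNr opprD !opprK; apply: le_trans (dist_le p bq) _.
  by rewrite (le_trans (enormD _ _))// enormN lerD2l bM.
rewrite lerNl opprB; apply: dist_ge => // q /bM qM.
have := enormD (p - q) q; rewrite subrK; lra.
Qed.

End Euclid.

(** * Null sets and porosity *)

Section NullSets.
Variables (R : realType) (n' : nat).
Local Notation n := n'.+1.
Local Notation V := 'rV[R]_n.
Local Notation lebo := (@lebo R n).
Implicit Types (p q u v w : V) (A B C E X : set V).

Definition null A := lebo A = 0%E.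

Lemma nullP A : (lebo A <= 0)%E -> null A.
Proof. by move=> A0; apply/eqP; rewrite eq_le A0 lebo_ge0. Qed.

Lemma sub_null A B : A `<=` B -> null B -> null A.
Proof. by move=> AB B0; apply: nullP; rewrite -B0 le_lebo. Qed.

Lemma null0 : null set0. Proof. exact: lebo0. Qed.

Lemma null_bigcup (F : nat -> set V) : (forall k, null (F k)) -> null (\bigcup_k F k).
Proof.
move=> F0; apply: nullP; apply: le_trans (lebo_sigma_subadditive _) _.
by rewrite eseries0// => k _ _; exact: F0.
Qed.

Lemma lebo_subU A B : (lebo (A `|` B) <= lebo A + lebo B)%E.
Proof. exact: outer_measureU2. Qed.

Lemma nullU A B : null A -> null B -> null (A `|` B).
Proof. by move=> A0 B0; apply: nullP; rewrite (le_trans (lebo_subU _ _))// A0 B0 adde0. Qed.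

Lemma null_lmeasurable A : null A -> lmeasurable A.
Proof.
move=> A0; apply: (@le_caratheodory_measurable R V lebo) => X.
rewrite [X in (X + _)%E](_ : _ = 0%E) ?add0e; first by apply: le_lebo; exact: subIsetl.
by apply: (sub_null _ A0); exact: subIsetr.
Qed.

Lemma le_lebo_ae A B : null (A `\` B) -> (lebo A <= lebo B)%E.
Proof.
move=> AB; rewrite -[leRHS]adde0 -AB; apply: le_trans (lebo_subU _ _).
by apply: le_lebo => p Ap; case: (pselect (B p)) => Bp; [left|right].
Qed.

Lemma eq_lebo_ae A B : null (A `\` B) -> null (B `\` A) -> lebo A = lebo B.
Proof. by move=> AB BA; apply/eqP; rewrite eq_le !le_lebo_ae. Qed.

Lemma lmeasurable_bigcup (F : nat -> set V) :
  (forall k, lmeasurable (F k)) -> lmeasurable (\bigcup_k F k).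
Proof. exact: caratheodory_measurable_bigcup. Qed.

Lemma lmeasurable_bigcap (F : nat -> set V) :
  (forall k, lmeasurable (F k)) -> lmeasurable (\bigcap_k F k).
Proof.
move=> mF; rewrite -(setCK (\bigcap_k _)) setC_bigcap.
apply: caratheodory_measurable_setC; apply: lmeasurable_bigcup => k.
by apply: caratheodory_measurable_setC; exact: mF.
Qed.

Lemma lebo_split B A : lmeasurable B -> (lebo A = lebo (A `&` B) + lebo (A `\` B))%E.
Proof. by move=> mB; rewrite (mB A) setDE. Qed.

Lemma bounded_lebo_lty A : bounded_set_e A -> (lebo A < +oo)%E.
Proof.
move=> [M AM]; apply: (@le_lt_trans _ _ (vol (const_mx (- M)) (const_mx M : V))%:E).
  apply: le_trans (lebo_box_le _ _); apply: le_lebo => p /AM pM i; rewrite !mxE.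
  by rewrite -ler_norml (le_trans _ pM)// coord_le_enorm.
by rewrite ltry.
Qed.

Lemma bounded_fin A : bounded_set_e A -> lebo A \is a fin_num.
Proof. by move=> bA; rewrite ge0_fin_numE ?lebo_ge0// bounded_lebo_lty. Qed.

Lemma sub_bounded A B : A `<=` B -> bounded_set_e B -> bounded_set_e A.
Proof. by move=> AB [M BM]; exists M => p /AB/BM. Qed.

Lemma boundedU A B : bounded_set_e A -> bounded_set_e B -> bounded_set_e (A `|` B).
Proof.
move=> [M AM] [N BN]; exists (Num.max M N) => p; rewrite le_max.
by move=> [/AM ->//|/BN ->]; rewrite orbT.
Qed.

Lemma bounded_closure A : bounded_set_e A -> bounded_set_e (closure A).
Proof. by move=> [M AM]; exists M; exact: closure_enorm_le. Qed.

Definition cube a (l : R) : set V := box a (a + const_mx l).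

Lemma lebo_cube a (l : R) : 0 <= l -> (lebo (cube a l) <= (l ^+ n)%:E)%E.
Proof.
move=> l0; apply: le_trans (lebo_box_le _ _) _; rewrite lee_fin /vol.
rewrite (eq_bigr (fun=> l)) ?prodr_const ?card_ord// => i _.
by rewrite !mxE (addrC (a _ _)) addrK; apply/max_idPl.
Qed.

(** The holes are cubes in the sup norm, to match the boxes of [lebo]; c and s0 are uniform over
    E. *)
Definition porous_at E (c s0 : R) := forall p, E p -> forall s, 0 < s <= s0 ->
  exists p', (forall i, `|p' ord0 i - p ord0 i| <= s) /\
    (forall q, (forall i, `|q ord0 i - p' ord0 i| < c * s) -> ~ E q).

Lemma ltn_trunc_grid (K : nat) (x l : R) : (0 < K)%N -> 0 < l -> 0 <= x <= l ->
  exists2 j : 'I_K, j%:R * (l / K%:R) <= x & x <= j%:R * (l / K%:R) + l / K%:R.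
Proof.
move=> K0 l0 /andP[x0 xl]; have K0' : 0 < K%:R :> R by rewrite ltr0n.
have h0 : 0 < l / K%:R by rewrite divr_gt0.
(* The right end x = l goes to the last closed cell, since truncation would return the index K. *)
have [xl'|xl'] := ltP x l; last first.
  have Kp : (K.-1 < K)%N by rewrite prednK.
  exists (Ordinal Kp) => /=; have -> : x = l by apply/eqP; rewrite eq_le xl xl'.
    by rewrite mulrA ler_pdivrMr// mulrC ler_wpM2l ?ler_nat ?leq_pred// ltW.
  rewrite -[X in _ + X]mul1r -mulrDl natr1 prednK//.
  by rewrite mulrCA mulfV ?mulr1// gt_eqF.
have y0 : 0 <= x / (l / K%:R) by rewrite divr_ge0// ltW.
have /andP[t1 t2] := truncn_itv y0.
have tK : (Num.truncn (x / (l / K%:R)) < K)%N.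
  rewrite -(ltr_nat R); apply: le_lt_trans t1 _.
  by rewrite ltr_pdivrMr// mulrCA mulfV ?mulr1// gt_eqF.
exists (Ordinal tK) => /=; first by rewrite -ler_pdivlMr.
by move: t2; rewrite ltr_pdivrMr// -natr1 mulrDl mul1r => /ltW.
Qed.

(* If the ratio lebo (E & Q) / |Q| has supremum M over all small cubes Q, cutting a
   cube into K^n pieces, one of which misses E, gives M <= (1 - K^-n) M. *)
Lemma porous_null E (c s0 : R) : 0 < c -> 0 < s0 -> porous_at E c s0 -> null E.
Proof.
wlog c1 : c / c <= 1.
  move=> H c0 s00 pE; apply: (H (Num.min c 1)); rewrite ?ge_min ?lexx ?orbT// ?lt_min ?c0 ?ltr01//.
  move=> p Ep s sP; have [p' [p'p p'E]] := pE p Ep s sP; exists p'; split=> // q qP.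
  apply: p'E => i; apply: lt_le_trans (qP i) _; rewrite ler_wpM2r ?ge_min ?lexx//.
  by case/andP: sP => /ltW.
move=> c0 s00 pE.
(* 4 < K c makes the side l / K of a cell smaller than the radius c l / 4 of a hole, so the cell
   containing the centre of the hole misses E. *)
have [K [K0 Kc]] : exists K : nat, (0 < K)%N /\ 4 < K%:R * c.
  exists (Num.truncn (4 / c)).+1; split=> //.
  by rewrite -ltr_pdivrMr// truncnS_gt.
have K0' : 0 < K%:R :> R by rewrite ltr0n.
have KnE : #|{: {ffun 'I_n -> 'I_K}}| = (K ^ n)%N by rewrite card_ffun !card_ord.
have fc a (l : R) : 0 <= l -> lebo (E `&` cube a l) \is a fin_num.
  move=> l0; rewrite ge0_fin_numE ?lebo_ge0//.
  apply: (le_lt_trans (le_lebo (@subIsetr _ _ _))).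
  by apply: le_lt_trans (lebo_cube _ l0) _; rewrite ltry.
pose r a (l : R) := fine (lebo (E `&` cube a l)) / l ^+ n.
have r1 a (l : R) : 0 < l -> r a l <= 1.
  move=> l0; rewrite /r ler_pdivrMr ?exprn_gt0// mul1r -lee_fin fineK ?fc ?(ltW l0)//.
  by apply: le_trans (lebo_cube _ (ltW l0)); apply: le_lebo; exact: subIsetr.
pose S := [set x | exists a (l : R), 0 < l <= s0 /\ x = r a l].
have hS : has_sup S.
  split; first by exists (r 0 s0), 0, s0; rewrite s00 lexx.
  by exists 1 => _ [a [l [/andP[l0 _] ->]]]; exact: r1.
pose M := sup S.
have rM a (l : R) : 0 < l <= s0 -> r a l <= M.
  by move=> ls; apply: ub_le_sup; [exact: hS.2|exists a, l].
have M0 : 0 <= M.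
  apply: le_trans (rM 0 s0 _); last by rewrite s00 lexx.
  by rewrite /r divr_ge0 ?fine_ge0 ?lebo_ge0// exprn_ge0// ltW.
(* If E meets the open middle half of the cube, porosity at scale l / 4 gives a hole whose centre is
   still in the cube. Otherwise the midpoint serves as centre, and c <= 1 keeps the hole within the
   middle half. *)
have key a (l : R) : 0 < l <= s0 ->
    exists p', cube a l p' /\
      (forall q, (forall i, `|q ord0 i - p' ord0 i| < c * (l / 4)) -> ~ E q).
  move=> /andP[l0 ls].
  pose m : V := a + const_mx (l / 2%:R).
  case: (pselect (exists p, E p /\ forall i, `|p ord0 i - m ord0 i| < l / 4)).
    move=> [p [Ep pm]]; have [|p' [p'p p'E]] := pE p Ep (l / 4); first by lra.
    exists p'; split=> // i; have := p'p i; have := pm i; rewrite !mxE.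
    rewrite ltr_norml ler_norml; lra.
  move=> NE; exists m; split=> [i|q qm Eq]; first by rewrite !mxE; lra.
  apply: NE; exists q; split=> // i; apply: lt_le_trans (qm i) _.
  by rewrite ler_piMl//; lra.
have step a (l : R) : 0 < l <= s0 -> r a l <= (1 - (K%:R ^+ n)^-1) * M.
  move=> ls; have [p' [p'a p'E]] := key a l ls; case/andP: (ls) => l0 _.
  pose h := l / K%:R; have h0 : 0 < h by rewrite divr_gt0.
  pose b (f : {ffun 'I_n -> 'I_K}) : V := a + \row_i ((f i)%:R * h).
  have grid q : cube a l q -> exists f, cube (b f) h q.
    move=> qa.
    have H i : exists j : 'I_K, j%:R * h <= q ord0 i - a ord0 i <= j%:R * h + h.
      have [|j j1 j2] := @ltn_trunc_grid K (q ord0 i - a ord0 i) l K0 l0.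
        by have := qa i; rewrite !mxE; lra.
      by exists j; rewrite j1 j2.
    have [f fP] := choice H.
    exists (finfun f) => i; rewrite !mxE !ffunE; have := fP i; lra.
  have [f0 f0p'] := grid _ p'a.
  have f0E : E `&` cube (b f0) h = set0.
    apply/seteqP; split=> // q [Eq qf]; apply: (p'E q) => // i.
    have hc : h < c * (l / 4).
      rewrite /h ltr_pdivrMr// (_ : c * _ * _ = l * (K%:R * c / 4)); last by ring.
      by rewrite ltr_pMr// ltr_pdivlMr// mul1r.
    have := qf i; have := f0p' i; rewrite !mxE ltr_norml; lra.
  rewrite /r ler_pdivrMr ?exprn_gt0// -lee_fin fineK ?fc ?(ltW l0)//.
  apply: (@le_trans _ _ (\sum_(f : {ffun 'I_n -> 'I_K}) lebo (E `&` cube (b f) h))%E).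
    have : E `&` cube a l `<=` \big[setU/set0]_(f : {ffun 'I_n -> 'I_K}) (E `&` cube (b f) h).
      move=> q [Eq /grid[f qf]]; rewrite (bigD1 f)//=; by left.
    move=> /le_lebo /le_trans; apply.
    apply: (big_ind2 (fun X y => (lebo X <= y)%E)) => //; first by rewrite lebo0.
    by move=> X x Y y Xx Yy; apply: le_trans (lebo_subU _ _) _; exact: leeD.
  rewrite (bigD1 f0)//= f0E lebo0 add0e.
  apply: (@le_trans _ _ (\sum_(f : {ffun 'I_n -> 'I_K} | f != f0) (M * h ^+ n)%:E)%E).
    apply: lee_sum => f _; rewrite -[leLHS]fineK ?fc ?(ltW h0)// lee_fin.
    rewrite -ler_pdivrMr ?exprn_gt0//; apply: rM; rewrite h0/=.
    case/andP: ls => _; apply: le_trans; rewrite ler_pdivrMr// ler_peMr ?(ltW l0)//; by rewrite ler1n K0.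
  rewrite sumEFin lee_fin sumr_const (cardC1 f0) KnE -subn1.
  rewrite -(mulr_natl (_ * _)) natrB ?expn_gt0 ?K0// natrX /h expr_div_n.
  have Kn : K%:R ^+ n != 0 :> R by rewrite expf_neq0// gt_eqF.
  by rewrite le_eqVlt; apply/orP; left; apply/eqP; field.
have {}M0 : M = 0.
  have ML : M <= (1 - (K%:R ^+ n)^-1) * M.
    apply: ge_sup; first exact: hS.1.
    by move=> _ [a [l [ls ->]]]; exact: step.
  apply/eqP; rewrite eq_le M0 andbT.
  have Kn : 0 < (K%:R ^+ n)^-1 :> R by rewrite invr_gt0 exprn_gt0.
  rewrite leNgt; apply/negP => Mp; have := mulr_gt0 Kn Mp; move: ML.
  rewrite mulrBl mul1r; lra.
have cube0 a (l : R) : 0 < l <= s0 -> null (E `&` cube a l).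
  move=> ls; have := rM a l ls; rewrite M0 /r; case/andP: ls => l0 _.
  rewrite ler_pdivrMr ?exprn_gt0// mul0r => H; apply: nullP.
  by rewrite -[leLHS]fineK ?fc ?(ltW l0)// lee_fin.
apply: (@sub_null _ (\bigcup_k (if @unpickle 'rV[int]_n k is Some z
    then E `&` cube (s0 *: map_mx intr z) s0 else set0))); last first.
  apply: null_bigcup => k; case: unpickle => [z|]; last exact: null0.
  by apply: cube0; rewrite s00 lexx.
move=> p Ep; exists (pickle (\row_i Num.floor (p ord0 i / s0))) => //.
rewrite pickleK; split=> // i; rewrite !mxE.
have /andP[] := floor_itv (p ord0 i / s0).
by rewrite ler_pdivlMr// ltr_pdivrMr// intrD mulrDl mul1r mulrC => -> /ltW.
Qed.

(** Where |f| reaches c s, the Lipschitz bound keeps f nonzero within c s / D, which is a hole of Z.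
    Since c and s0 depend on the point, Z is split into countably many pieces with uniform constants
    1 / (k + 1). *)
Lemma null_of_steep (f : V -> R) (D : R) (Z : set V) :
  (forall p q, `|f p - f q| <= D * enorm (p - q)) ->
  (forall p, Z p -> f p = 0) ->
  (forall p, Z p -> exists c s0 : R, [/\ 0 < c, 0 < s0 & forall s, 0 < s <= s0 ->
     exists p', enorm (p' - p) <= s /\ c * s <= `|f p'|]) ->
  null Z.
Proof.
wlog D0 : D / 0 < D.
  move=> H fL; apply: (H (Num.max D 1)); first by rewrite lt_max ltr01 orbT.
  move=> p q; apply: le_trans (fL p q) _; apply: ler_wpM2r; first exact: enorm_ge0.
  by rewrite le_max lexx.
move=> fL Z0 ZP.
pose Zk k := [set p | Z p /\ forall s, 0 < s <= k.+1%:R^-1 ->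
     exists p', enorm (p' - p) <= s /\ k.+1%:R^-1 * s <= `|f p'|].
apply: (@sub_null _ (\bigcup_k Zk k)).
  move=> p Zp; have [c [s0 [c0 s00 H]]] := ZP p Zp.
  have : 0 < Num.min c s0 by rewrite lt_min c0.
  move=> /ltr_add_invr[k]; rewrite add0r lt_min => /andP[kc ks]; exists k => //.
  split=> // s /andP[ss sk]; have [|p' [p'p fp']] := H s; first by rewrite ss/= (le_trans sk)// ltW.
  by exists p'; split=> //; apply: le_trans fp'; rewrite ler_wpM2r// ltW.
apply: null_bigcup => k.
(* The factor n converts the Euclidean radius of the hole to the sup norm. *)
apply: (@porous_null _ (k.+1%:R^-1 / (D * n%:R)) k.+1%:R^-1).
- by rewrite divr_gt0// mulr_gt0.
- by [].
move=> p [Zp H] s sk; have [p' [p'p fp']] := H s sk; exists p'; split.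
  move=> i; apply: le_trans p'p; by have := coord_le_enorm (p' - p) i; rewrite !mxE.
move=> q qp' [Zq _]; have := fL p' q; rewrite (Z0 _ Zq) subr0 => /(le_trans fp').
apply/negP; rewrite -ltNge enormB.
case/andP: sk => s0 _.
have H1 : enorm (q - p') < k.+1%:R^-1 * s / D.
  have [i0 _ i0P] := @arg_maxP _ _ _ ord0 xpredT (fun i => `|q ord0 i - p' ord0 i|) isT.
  apply: (@le_lt_trans _ _ (n%:R * `|q ord0 i0 - p' ord0 i0|)).
    by apply: enorm_le_coord => i; rewrite !mxE; exact: i0P.
  have := qp' i0; rewrite -(ltr_pM2l (_ : 0 < n%:R :> R))//.
  move/lt_le_trans; apply; rewrite le_eqVlt; apply/orP; left; apply/eqP.
  by field; rewrite ?gt_eqF//= ?ltr0n//; lra.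
by rewrite mulrC -ltr_pdivlMr.
Qed.

End NullSets.

(** * Regular closed sets, and level sets of prescribed measure *)

Section RegularSets.
Variables (R : realType) (n' : nat).
Local Notation n := n'.+1.
Local Notation V := 'rV[R]_n.
Local Notation lebo := (@lebo R n).
Implicit Types (p q u v w : V) (A B C E X : set V).

Lemma bnd_lmeasurable A : null (bnd A) -> lmeasurable A.
Proof.
move=> bA; have -> : A = interior A `|` (A `&` bnd A).
  apply/seteqP; split=> p; last by move=> [/interior_subset|[]].
  move=> Ap; case: (pselect (interior A p)) => iA; first by left.
  by right; split=> //; split=> //; exact: subset_closure.
apply: caratheodory_measurable_setU; first exact/open_lmeasurable/open_interior.
by apply: null_lmeasurable; apply: sub_null bA; exact: subIsetr.
Qed.

Lemma bndU A B : bnd (A `|` B) `<=` bnd A `|` bnd B.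
Proof.
move=> p; rewrite /bnd closureU => -[[cp|cp] ip]; [left|right]; split=> // iA; apply: ip.
  by apply: interiorS iA; exact: subsetUl.
by apply: interiorS iA; exact: subsetUr.
Qed.

Lemma bndI A B : bnd (A `&` B) `<=` bnd A `|` bnd B.
Proof.
move=> p [cp ip]; have cA : closure A p by apply: closureS cp; exact: subIsetl.
have cB : closure B p by apply: closureS cp; exact: subIsetr.
case: (pselect (interior A p)) => iA; last by left.
case: (pselect (interior B p)) => iB; last by right.
by case: ip; rewrite interiorI.
Qed.

Lemma sub_interior_ci A : interior A `<=` ci A.
Proof. exact: subset_closure. Qed.

Lemma ci_sub_closure A : ci A `<=` closure A.
Proof. by apply: closureS; exact: interior_subset. Qed.

Lemma closed_ci A : closed (ci A). Proof. exact: closed_closure. Qed.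

Lemma interior_sub_interior_ci A : interior A `<=` interior (ci A).
Proof. rewrite -[X in X `<=` _](interior_id _).1; last exact: open_interior.
by apply: interiorS; exact: sub_interior_ci. Qed.

Lemma ciK A : ci (ci A) = ci A.
Proof.
apply/seteqP; split; last by apply: closureS; exact: interior_sub_interior_ci.
rewrite {2}(closure_id (ci A)).1; last exact: closed_ci.
by apply: closureS; exact: interior_subset.
Qed.

Lemma bnd_ci A : bnd (ci A) `<=` bnd A.
Proof.
move=> p [cp ip]; split; last by move=> /interior_sub_interior_ci.
by apply: ci_sub_closure; rewrite (closure_id (ci A)).1//; exact: closed_ci.
Qed.

Lemma ci_inJ A : bounded_set_e A -> null (bnd A) -> inJ (ci A).
Proof.
move=> bA nA; split; first exact: sub_bounded (@ci_sub_closure A) (bounded_closure bA).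
by rewrite ciK; split=> //; apply: sub_null nA; exact: bnd_ci.
Qed.

Lemma ci_ae A : null (bnd A) -> null (A `\` ci A) /\ null (ci A `\` A).
Proof.
move=> nA; split; apply: sub_null nA => p [Ap NAp]; split.
- exact: subset_closure.
- by move=> /sub_interior_ci.
- exact: ci_sub_closure.
- by move=> /interior_subset.
Qed.

Lemma inJ_closed A : inJ A -> closed A.
Proof. by move=> [_ [-> _]]; exact: closed_ci. Qed.

Lemma inJ_bounded A : inJ A -> bounded_set_e A. Proof. by case. Qed.

Lemma inJ_bnd A : inJ A -> null (bnd A). Proof. by move=> [_ []]. Qed.

Lemma inJ_lmeasurable A : inJ A -> lmeasurable A.
Proof. by move=> /inJ_bnd/bnd_lmeasurable. Qed.

Lemma bnd0 : bnd (set0 : set V) = set0.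
Proof. by rewrite /bnd closure0 set0D. Qed.

Lemma inJ0 : inJ (set0 : set V).
Proof.
split; first by exists 0.
by rewrite /ci interior0 closure0 bnd0; split => //; exact: lebo0.
Qed.

Lemma inJU A B : inJ A -> inJ B -> inJ (A `|` B).
Proof.
move=> JA JB; split; first exact: boundedU (inJ_bounded JA) (inJ_bounded JB).
split; last by apply: sub_null (@bndU A B) _; apply: nullU; exact: inJ_bnd.
apply/seteqP; split; last first.
  move=> p /ci_sub_closure; rewrite closureU.
  by rewrite -(closure_id A).1 -?(closure_id B).1//; exact: inJ_closed.
case: JA => _ [EA _]; case: JB => _ [EB _]; rewrite {1}EA {1}EB /ci -closureU.
by apply: closureS => p [] ip; apply: interiorS ip; [exact: subsetUl|exact: subsetUr].
Qed.

Lemma lebo_bigcup_le (F : nat -> set V) T : (forall k, lmeasurable (F k)) ->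
  nondecreasing_seq F -> (forall k, (lebo (F k) <= T)%E) -> (lebo (\bigcup_k F k) <= T)%E.
Proof.
move=> mF ndF FT.
pose mu : {outer_measure set V -> \bar R} := lebo.
have H := @nondecreasing_cvg_mu _ (caratheodory_type mu) R (mu : set (caratheodory_type mu) -> \bar R) F mF
  (lmeasurable_bigcup mF) ndF.
have <- : limn (mu \o F) = lebo (\bigcup_k F k) by exact: (cvg_lim _ H).
apply: lime_le; first exact: cvgP H.
by apply: nearW => k; exact: FT.
Qed.

Lemma lebo_bigcap_ge (F : nat -> set V) T : (forall k, lmeasurable (F k)) ->
  (lebo (F 0%N) < +oo)%E ->
  nonincreasing_seq F -> (forall k, (T <= lebo (F k))%E) -> (T <= lebo (\bigcap_k F k))%E.
Proof.
move=> mF F0 ndF FT.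
pose mu : {outer_measure set V -> \bar R} := lebo.
have H := @nonincreasing_cvg_mu _ (caratheodory_type mu) R (mu : set (caratheodory_type mu) -> \bar R) F F0 mF
  (lmeasurable_bigcap mF) ndF.
have <- : limn (mu \o F) = lebo (\bigcap_k F k) by exact: (cvg_lim _ H).
apply: lime_ge; first exact: cvgP H.
by apply: nearW => k; exact: FT.
Qed.

(** The level sought is the supremum s of those with measure at most T. From above, S s is exactly
    the intersection of the S t with t > s; from below, the union of the S t with t < s can miss
    only the level set at s. Nullity is asked for x > 0 only, because in [Oball_between] the level
    set at 0 is B itself. *)
Lemma lebo_level_ivt (D : set V) (b c : V -> R) (X : R) (T : \bar R) :
  let S (x : R) := [set p | D p /\ 0 <= b p + x * c p] in
  0 <= X -> (forall p, 0 <= c p) -> (lebo (S X) < +oo)%E ->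
  (forall x : R, (0 <= x <= X)%R -> lmeasurable (S x)) ->
  (forall x : R, 0 < x <= X -> null [set p | D p /\ b p + x * c p = 0]) ->
  (lebo (S 0%R) <= T <= lebo (S X))%E ->
  exists2 x, 0 <= x <= X & lebo (S x) = T.
Proof.
move=> S X0 c0 SX mS nS /andP[S0T TSX].
have Smono x y : x <= y -> S x `<=` S y.
  move=> xy p [Dp xp]; split=> //; apply: le_trans xp _.
  by rewrite lerD2l ler_wpM2r.
pose Q := [set x : R | 0 <= x <= X /\ (lebo (S x) <= T)%E].
have hQ : has_sup Q.
  by split; [exists 0; split; rewrite ?lexx|exists X => x [/andP[]]].
pose s := sup Q.
have s0 : 0 <= s by apply: ub_le_sup; [exact: hQ.2|split; rewrite ?lexx].
have sX : s <= X by apply: ge_sup; [exact: hQ.1|move=> x [/andP[]]].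
exists s; first by rewrite s0.
apply/eqP; rewrite eq_le; apply/andP; split.
  have [<-//|s0'] := eqVneq 0 s; have {}s0' : 0 < s by rewrite lt_neqAle s0'.
  (* The sequence starts at t 0 = 0, which serves the points where s c(p) = 0. *)
  pose t k : R := s - s / k.+1%:R.
  have ts k : t k < s by rewrite ltrBlDr ltrDl divr_gt0.
  have t0 k : 0 <= t k by rewrite subr_ge0 ler_pdivrMr// ler_peMr// ler1n.
  have St k : (lebo (S (t k)) <= T)%E.
    have [x [_ xT] tx] := sup_gt hQ.1 (ts k).
    by apply: le_trans xT; apply: le_lebo; apply: Smono; exact: ltW.
  have tn i j : (i <= j)%N -> t i <= t j.
    by move=> ij; rewrite lerB// ler_pM2l// lef_pV2 ?posrE// ler_nat ltnS.
  apply: (@le_trans _ _ (lebo (\bigcup_k S (t k)))); last first.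
    apply: lebo_bigcup_le => // [k|i j ij].
      by apply: mS; rewrite t0 (le_trans (ltW (ts k))).
    by apply/subsetPset; exact/Smono/tn.
  apply: le_lebo_ae; apply: (@sub_null _ _ _ [set p | D p /\ b p + s * c p = 0]);
    last by apply: nS; rewrite s0'.
  move=> p [[Dp sp] Np]; split=> //; apply/eqP; apply: contrapT => /negP H.
  have {H}sp : 0 < b p + s * c p by rewrite lt_neqAle eq_sym H.
  apply: Np; have [cp|cp] := eqVneq (s * c p) 0.
    exists 0%N => //; split=> //; move: sp.
    by rewrite /t divr1 subrr mul0r cp => /ltW.
  have {}cp : 0 < s * c p by rewrite lt_neqAle eq_sym cp mulr_ge0.
  have : 0 < (b p + s * c p) / (s * c p) by rewrite divr_gt0.
  move=> /ltr_add_invr[k]; rewrite add0r ltr_pdivlMr// => H.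
  exists k => //; split=> //; rewrite /t mulrBl addrA subr_ge0 ltW//.
  by rewrite mulrAC mulrC.
have [sX'|sX'] := eqVneq s X; first by rewrite sX'.
have {}sX' : s < X by rewrite lt_neqAle sX'.
pose t k : R := Num.min (s + k.+1%:R^-1) X.
have ts k : s < t k by rewrite lt_min sX' ltrDl invr_gt0 ltr0n.
have tX k : t k <= X by rewrite ge_min lexx orbT.
have St k : (T <= lebo (S (t k)))%E.
  rewrite leNgt; apply/negP => H; suff : t k <= s by rewrite leNgt ts.
  apply: ub_le_sup; first exact: hQ.2.
  by split; [rewrite tX (le_trans s0 (ltW (ts k)))|exact: ltW].
have tn i j : (i <= j)%N -> t j <= t i.
  move=> ij; rewrite le_min tX andbT ge_min lerD2l lef_pV2 ?posrE//.
  by rewrite ler_nat ltnS ij.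
have -> : S s = \bigcap_k S (t k).
  apply/seteqP; split=> [p Sp k _|p H]; first by apply: Smono Sp; exact: ltW.
  split; first by have [] := H 0%N I.
  rewrite leNgt; apply/negP => H'.
  have [cp|cp] := eqVneq (c p) 0.
    by have [_] := H 0%N I; move: H'; rewrite cp !mulr0; lra.
  have {}cp : 0 < c p by rewrite lt_neqAle eq_sym cp c0.
  have : 0 < - (b p + s * c p) / c p by rewrite divr_gt0// oppr_gt0.
  move=> /ltr_add_invr[k]; rewrite add0r ltr_pdivlMr// => Hk.
  have H2 : t k * c p <= (s + k.+1%:R^-1) * c p by rewrite ler_wpM2r ?(ltW cp)// ge_min lexx.
  have [_ H3] := H k I; move: H2 H3 Hk H'; rewrite mulrDl.
  by move: (t k * c p) (b p) (s * c p) (k.+1%:R^-1 * c p) => x1 x2 x3 x4; lra.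
apply: lebo_bigcap_ge => //.
- by move=> k; apply: mS; rewrite tX (le_trans s0 (ltW (ts k))).
- by apply: le_lt_trans SX; apply: le_lebo; apply: Smono.
- by move=> i j ij; apply/subsetPset; exact/Smono/tn.
Qed.

Lemma null1 q : null [set q].
Proof.
apply: nullP; apply/lee_addgt0Pr => e e0; rewrite add0e.
pose l := Num.min e 1; have l0 : 0 < l by rewrite lt_min e0 ltr01.
apply: (@le_trans _ _ (lebo (cube q l))).
  by apply: le_lebo => _ -> i; rewrite !mxE lexx lerDl ltW.
apply: le_trans (lebo_cube _ (ltW l0)) _; rewrite lee_fin.
apply: (@le_trans _ _ l); last by rewrite ge_min lexx.
by rewrite exprS ler_piMr ?(ltW l0)// exprn_ile1 ?(ltW l0)// ge_min lexx orbT.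
Qed.

(** An almost nearest point y suffices: a move of length s towards it shortens the distance to D0 by
    s, up to the error d, which the callers choose small relative to s. *)
Lemma toward_near_point (D0 : set V) p (s d : R) : D0 !=set0 -> 0 < s <= dist p D0 -> 0 < d ->
  exists y u, [/\ D0 y, enorm u = 1, y = p + enorm (y - p) *: u,
    enorm (y - p) < dist p D0 + d & dist (p + s *: u) D0 <= dist p D0 - s + d].
Proof.
move=> D00 /andP[s0 sd] d0; have [y Dy py] := dist_approx p D00 d0.
have pyd := dist_le p Dy; rewrite (enormB p y) in py pyd.
have y0 : 0 < enorm (y - p) by apply: lt_le_trans pyd; exact: lt_le_trans sd.
have yE : y = p + enorm (y - p) *: ((enorm (y - p))^-1 *: (y - p)).
  by rewrite scalerA mulfV ?gt_eqF// scale1r addrC subrK.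
exists y, ((enorm (y - p))^-1 *: (y - p)); split=> //.
  by rewrite enormZ ger0_norm ?invr_ge0 ?ltW// mulVf// gt_eqF.
apply: le_trans (dist_le _ Dy) _.
rewrite (_ : _ - y = (s / enorm (y - p) - 1) *: (y - p)); last first.
  by rewrite scalerA scalerBl scale1r opprB addrAC addrC.
rewrite enormZ ler0_norm; last by rewrite subr_le0 ler_pdivrMr// mul1r; apply: le_trans pyd.
by rewrite opprB mulrBl mul1r divfK ?gt_eqF//; lra.
Qed.

(* Moving towards D0 changes [al * phi] at rate [`|al|], but [psi] at rate at most [l]. *)
Lemma null_level (D0 : set V) (phi psi : V -> R) (al l : R) :
  D0 !=set0 -> (forall p, `|phi p| = dist p D0) ->
  (forall p q, `|phi p - phi q| <= enorm (p - q)) ->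
  (forall p q, `|psi p - psi q| <= l * enorm (p - q)) -> 0 <= l < `|al| ->
  null [set p | al * phi p + psi p = 0 /\ phi p != 0].
Proof.
move=> D00 phiD phiL psiL /andP[l0 lal].
apply: (@null_of_steep _ _ (fun p => al * phi p + psi p) (`|al| + l)).
- move=> p q; rewrite (_ : _ - _ = al * (phi p - phi q) + (psi p - psi q)); last by ring.
  apply: le_trans (ler_normD _ _) _; rewrite mulrDl lerD// normrM.
  by rewrite ler_wpM2l.
- by move=> p [].
move=> p [fp phip]; pose c : R := (`|al| - l) / 2.
have c0 : 0 < c by rewrite divr_gt0// subr_gt0.
have al0 : 0 < `|al| by exact: le_lt_trans lal.
have dp : 0 < dist p D0 by rewrite -phiD normr_gt0.
exists c, (dist p D0); split=> // s /andP[s0 sd].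
(* After multiplication by |al| this error costs c s. With |al| - l = 2 c the net change is at least
   |al| s - c s - l s = c s. *)
have [||y [u [_ u1 _ _ H]]] := @toward_near_point D0 p s (c * s / `|al|) D00.
- by rewrite s0.
- by rewrite divr_gt0// mulr_gt0.
exists (p + s *: u); rewrite addrC addKr enormZ u1 mulr1 gtr0_norm//; split=> //.
rewrite addrC.
have H1 : s - c * s / `|al| <= `|phi (p + s *: u) - phi p|.
  have := lerB_dist (phi p) (phi (p + s *: u)); rewrite !phiD distrC; lra.
have H2 : `|psi (p + s *: u) - psi p| <= l * s.
  apply: le_trans (psiL _ _) _.
  by rewrite (addrC p) addrK enormZ u1 mulr1 gtr0_norm.
have H3 : `|al| * (s - c * s / `|al|) <= `|al * (phi (p + s *: u) - phi p)|.
  by rewrite normrM ler_pM2l.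
have H4 : `|al| * (s - c * s / `|al|) = `|al| * s - c * s.
  by field; rewrite gt_eqF.
have H5 := lerB_dist (al * (phi (p + s *: u) - phi p)) (- (psi (p + s *: u) - psi p)).
rewrite opprK normrN in H5.
rewrite (_ : psi _ + al * _ = al * (phi (p + s *: u) - phi p) + (psi (p + s *: u) - psi p));
  last by move: fp; lra.
have H6 : c * s = (`|al| * s - l * s) / 2 by rewrite /c; ring.
rewrite H4 in H3; apply: le_trans H5; lra.
Qed.

(* On the zero set the nearest boundary point and the center q are equidistant from p;
   if they lay in almost the same direction then q would be near the boundary. *)
Lemma null_bisector A q : bounded_set_e A -> A !=set0 -> (forall p, dS A p <= dS A q) ->
  null [set p | dS A p = enorm (p - q)].
Proof.
move=> bA A0 qmax; have bndA := bnd_neq0 bA A0.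
have [q0|q0] := leP (dS A q) 0.
  apply: (@sub_null _ _ _ [set q]); last exact: null1.
  move=> p /= pq; apply/eqP; rewrite -subr_eq0; apply/eqP/enorm_eq0/eqP.
  by rewrite eq_le enorm_ge0 andbT -pq (le_trans (qmax p)).
have Aq : A q.
  by apply: contrapT => Aq; move: q0; rewrite dS_out// oppr_gt0 ltNge dist_ge0.
set rho := dS A q in q0.
apply: (@null_of_steep _ _ (fun p => dS A p - enorm (p - q)) 2).
- move=> p p'; have := dS_lip A p p'; have := dist_lip p p' [set q].
  rewrite !dist1 !ler_norml; lra.
- by move=> p /= ->; rewrite subrr.
move=> p /= pq; set s := enorm (p - q) in pq.
have s0 : 0 < s.
  rewrite lt_neqAle enorm_ge0 andbT eq_sym; apply/eqP => s0.
  have pq' : p = q by apply/eqP; rewrite -subr_eq0; apply/eqP/enorm_eq0.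
  by move: q0; rewrite /rho -pq' pq s0 ltxx.
have Ap : A p.
  by apply: contrapT => Ap; move: s0; rewrite -pq dS_out// oppr_gt0 ltNge dist_ge0.
have sE : dist p (bnd A) = s by rewrite -dS_in.
(* With u pointing from p to y, v from q to p and w their inner product, |y - q| >= rho and an
   excess |y - p| - s of at most rho / 2 give s |u + v| >= rho / 2. Since |u + v|^2 = 2 + 2 w, this
   is 1 + w >= ka. A move by e along u lowers [dS A] by at least e - d and changes |p - q| by at
   least e w; with d <= e ka / 2 the function drops to - e ka / 2 or below. *)
pose ka := rho ^+ 2 / (8 * s ^+ 2); have ka0 : 0 < ka by rewrite divr_gt0 ?mulr_gt0 ?exprn_gt0.
exists (ka / 2), s; split=> //; first by rewrite divr_gt0.
move=> e /andP[e0 es].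
pose d := Num.min (e * ka / 2) (rho / 2).
have d0 : 0 < d by rewrite lt_min !divr_gt0// mulr_gt0.
have d1 : d <= e * ka / 2 by rewrite ge_min lexx.
have d2 : d <= rho / 2 by rewrite ge_min lexx orbT.
have [||y [u [by_ u1 yE yd H]]] := @toward_near_point (bnd A) p e d bndA.
- by rewrite sE e0.
- by [].
exists (p + e *: u); rewrite addrC addKr enormZ u1 mulr1 gtr0_norm//; split=> //.
rewrite addrC.
have [v [v1 pqE]] : exists v, enorm v = 1 /\ p - q = s *: v.
  exists (s^-1 *: (p - q)); rewrite enormZ gtr0_norm ?invr_gt0// mulVf ?gt_eqF//.
  by rewrite scalerA mulfV ?scale1r// gt_eqF.
pose w := dot u v.
have vE : dot v v = 1 by rewrite -enorm_sqr v1 expr1n.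
have H1 : s + e * w <= enorm (p + e *: u - q).
  have := cauchy_schwarz (p + e *: u - q) v; rewrite v1 mulr1; apply: le_trans.
  by rewrite addrAC pqE dotDl !dotZl vE mulr1.
have H2 : dS A (p + e *: u) <= s - e + d.
  by rewrite -sE; apply: le_trans H; rewrite -dS_norm ler_norm.
have yps : s <= enorm (y - p) by rewrite -sE enormB dist_le.
rewrite sE in yd.
have yq : rho <= enorm (y - q) by rewrite /rho dS_in// enormB dist_le.
have H3 : rho / 2 <= s * enorm (u + v).
  have : enorm (y - q) <= s * enorm (u + v) + (enorm (y - p) - s).
    rewrite (_ : y - q = s *: (u + v) + (enorm (y - p) - s) *: u).
      apply: le_trans (enormD _ _) _.
      by rewrite !enormZ u1 mulr1 gtr0_norm// ger0_norm// subr_ge0.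
    rewrite scalerDr -pqE scalerBl addrACA addrC [in LHS]yE.
    by rewrite [RHS]addrA subrK addrAC.
  lra.
have H4 : ka <= 1 + w.
  rewrite /ka ler_pdivrMr ?mulr_gt0 ?exprn_gt0//.
  have : (rho / 2) ^+ 2 <= (s * enorm (u + v)) ^+ 2.
    by rewrite lerXn2r ?nnegrE ?divr_ge0 ?mulr_ge0 ?enorm_ge0// ltW.
  rewrite [X in _ <= X]exprMn (enorm_sqrD u v) u1 v1 -/w; lra.
have H5 : e * ka <= e * (1 + w) by rewrite ler_pM2l.
rewrite ler0_norm; lra.
Qed.

(** The hypothesis on [qsel] applies only if a maximizer exists, and A need not be closed here. A
    maximum over the compact closure that is attained outside A has value at most 0, and then every
    point of A is a maximizer. *)
Lemma dS_argmax A : bounded_set_e A -> A !=set0 ->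
  exists q, A q /\ forall p, A p -> dS A p <= dS A q.
Proof.
move=> bA A0; have [p0 Ap0] := A0.
have cA : compact (closure A).
  apply: bounded_closed_compact; last exact: closed_closure.
  have [M AM] := bounded_closure bA; exists M; split; first exact: num_real.
  move=> x Mx p /AM pM; rewrite /Num.Def.normr/= mx_normrE; apply: bigmax_le.
    by apply: le_trans (ltW Mx); apply: le_trans pM; exact: enorm_ge0.
  move=> [i j] _ /=; rewrite (ord1 i); apply: le_trans (coord_le_enorm p j) _.
  by apply: le_trans pM (ltW Mx).
have dc : {within closure A, continuous (dS A)}.
  apply: continuous_subspaceT => p U /nbhs_ballP[e /= e0 eU].
  apply/nbhs_enormP; exists e => // q pq; apply: eU.
  exact: le_lt_trans (dS_lip A p q) pq.
have [z zA zmax] := compact_EVT_max (ex_intro _ p0 (subset_closure Ap0)) cA dc.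
have {}zmax p : A p -> dS A p <= dS A z.
  by move=> Ap; apply: zmax; rewrite inE; exact: subset_closure.
case: (pselect (A z)) => Az; first by exists z.
exists p0; split=> // p Ap; apply: le_trans (dS_in_ge0 Ap0).
by apply: le_trans (zmax p Ap) _; rewrite dS_out// oppr_le0 dist_ge0.
Qed.

End RegularSets.

(** * Averages of simply different pairs *)

Section SimpleAverage.
Variables (R : realType) (n' : nat).
Local Notation n := n'.+1.
Local Notation V := 'rV[R]_n.
Local Notation lebo := (@lebo R n).
Implicit Types (p q u v w : V) (A B C E X : set V).

Lemma lebo_mu A : bounded_set_e A -> lebo A = (mu A)%:E.
Proof. by move=> /bounded_fin/fineK. Qed.

Lemma null_diff A B : A `<=` B -> lmeasurable A -> (lebo A < +oo)%E ->
  lebo B = lebo A -> null (B `\` A).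
Proof.
move=> AB mA Aoo; rewrite (lebo_split B mA) (setIidr AB) => H.
have fA : lebo A \is a fin_num by rewrite ge0_fin_numE ?lebo_ge0.
have := congr1 (fun z => z - lebo A)%E H; rewrite addeAC !subee// add0e.
exact.
Qed.

Lemma bnd_level (f : V -> R) K : (forall p q, `|f p - f q| <= K * enorm (p - q)) ->
  bnd [set p | 0 <= f p] `<=` [set p | f p = 0].
Proof.
move=> fL p [/closure_enormP cp ip].
wlog K0 : K fL / 0 < K.
  move=> H; apply: (H (Num.max K 1)); last by rewrite lt_max ltr01 orbT.
  move=> x y; apply: le_trans (fL x y) _; apply: ler_wpM2r; first exact: enorm_ge0.
  by rewrite le_max lexx.
apply/eqP; rewrite eq_le; apply/andP; split; rewrite leNgt; apply/negP => fp.
- apply: ip; apply/interior_enormP; exists (f p / K); first by rewrite divr_gt0.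
  move=> q; rewrite ltr_pdivlMr// mulrC => /(le_lt_trans (fL p q)).
  by rewrite ltr_norml /=; lra.
- have [|q /= fq] := cp (- f p / K); first by rewrite divr_gt0// oppr_gt0.
  rewrite ltr_pdivlMr// mulrC => /(le_lt_trans (fL p q)).
  by rewrite ltr_norml /=; lra.
Qed.

(** Metric betweenness for B contained in A, modulo null sets: together with the inclusions, the
    measure determines both distances from E. *)
Definition avg_between (t : R) A B E := [/\ inJ E, null (B `\` E), null (E `\` A) &
  lebo E = (t * mu A + (1 - t) * mu B)%:E].

Lemma ci_between (t : R) A B E : bounded_set_e E -> null (bnd E) ->
  null (B `\` E) -> null (E `\` A) -> lebo E = (t * mu A + (1 - t) * mu B)%:E ->
  avg_between t A B (ci E).
Proof.
move=> bE nE BE EA tE; have [n1 n2] := ci_ae nE; split; first exact: ci_inJ.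
- apply: sub_null (nullU BE n1) => p [Bp Np].
  by case: (pselect (E p)) => Ep; [right|left].
- apply: sub_null (nullU n2 EA) => p [Bp Np].
  by case: (pselect (E p)) => Ep; [right|left].
- by rewrite -tE; apply: eq_lebo_ae.
Qed.

(* The two cases of the distance average share the form x a + (1 - x) b. *)
Lemma davgfun_affine qsel A B : bounded_set_e A -> A !=set0 -> null (bnd A) -> inJ B ->
  B `<=` A ->
  (forall A : set V, (exists q, A q /\ forall p, A p -> dS A p <= dS A q) ->
     A (qsel A) /\ forall p, A p -> dS A p <= dS A (qsel A)) ->
  exists b : V -> R,
  [/\ forall x p, davgfun qsel A B x p = x * dS A p + (1 - x) * b p,
      forall p, b p <= dS A p,
      exists2 D : set V, D !=set0 & forall p, `|b p| = dist p D &
      forall p q, `|b p - b q| <= enorm (p - q)] /\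
  [/\ B `<=` [set p | 0 <= b p],
      null ([set p | 0 <= b p] `\` B),
      null [set p | b p = 0],
      exists M, forall p, M < enorm p -> - enorm p - M <= b p <= M - enorm p &
      B = set0 \/ zmc A B -> null [set p | 2^-1 * dS A p + 2^-1 * b p = 0] ].
Proof.
move=> bA A0 nA JB BA qselP; have bndA := bnd_neq0 bA A0.
have [[M AM] cB nB] := And3 bA (inJ_closed JB) (inJ_bnd JB).
have [BE|/set0P B0] := eqVneq B set0; last first.
  have bB := inJ_bounded JB; have bndB := bnd_neq0 bB B0.
  exists (dS B); split; split.
  - by move=> x p; rewrite /davgfun; case: pselect => // BE /=; case: B0 => z; rewrite {1}BE.
  - by move=> p; exact: dS_mono.
  - by exists (bnd B) => // p; exact: dS_norm.
  - exact: dS_lip.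
  - by move=> p Bp; exact: dS_in_ge0.
  - rewrite (_ : _ `\` _ = set0); first exact: null0.
    by apply/seteqP; split=> // p [/(dS_ge0 bndB)]; rewrite -(closure_id B).1.
  - by apply: sub_null nB => p; exact: dS_eq0.
  - by exists M => p Mp; apply: dS_far => // q /BA; exact: AM.
  - by move=> [BE|//]; case: B0 => z; rewrite BE.
have [Aq qmax'] := qselP A (dS_argmax bA A0); set q := qsel A in Aq qmax'.
have qmax p : dS A p <= dS A q.
  case: (pselect (A p)) => Ap; first exact: qmax'.
  by apply: le_trans (dS_in_ge0 Aq); rewrite dS_out// oppr_le0 dist_ge0.
(* The point q stands in for the empty set: (x - 1) |p - q| is (1 - x) times the signed distance of
   {q}. It lies below [dS A] because [dS A] is 1-Lipschitz and nonnegative at q. *)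
exists (fun p => - enorm (p - q)); split; split.
- by move=> x p; rewrite /davgfun; case: pselect => //= ?; rewrite -/q; ring.
- move=> p; have := dS_lip A p q; have := dS_in_ge0 Aq; rewrite ler_norml; lra.
- by exists [set q]; [exists q|move=> p; rewrite dist1 normrN ger0_norm ?enorm_ge0].
- move=> p p'; have := dist_lip p p' [set q]; rewrite !dist1 !ler_norml; lra.
- by rewrite BE.
- apply: sub_null (null1 q) => p [/=]; rewrite oppr_ge0 => pq _.
  apply/eqP; rewrite -subr_eq0; apply/eqP/enorm_eq0/eqP.
  by rewrite eq_le pq enorm_ge0.
- apply: sub_null (null1 q) => p /= /eqP; rewrite oppr_eq0 => /eqP/enorm_eq0/eqP.
  by rewrite subr_eq0 => /eqP.
- exists M => p Mp; have := AM q Aq; have := enormD (p - q) q; have := enormD p (- q).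
  rewrite subrK enormN; lra.
- move=> _; apply: sub_null (null_bisector bA A0 qmax) => p /=; lra.
Qed.

(** For g other than 1/2 the weights g and 1 - g have different absolute values, so [null_level]
    applies with the heavier term as the steep one. Where the heavier function vanishes, its own
    zero set is null. *)
Lemma null_mix_level A (b : V -> R) (D : set V) (g : R) : bnd A !=set0 -> null (bnd A) ->
  D !=set0 -> (forall p, `|b p| = dist p D) ->
  (forall p q, `|b p - b q| <= enorm (p - q)) -> null [set p | b p = 0] ->
  g != 2^-1 -> null [set p | g * dS A p + (1 - g) * b p = 0].
Proof.
move=> bndA nA D0 bD bL nb g2.
have na : null [set p | dS A p = 0] by apply: sub_null nA => p; exact: dS_eq0.
have [lt|lt|/eqP] := ltgtP `|g| `|1 - g|; last 1 first.
- rewrite eqr_norm2 => /orP[]/eqP ?; exfalso; last by lra.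
  by move/eqP: g2; apply; lra.
- have H := @null_level _ _ D b (fun p => g * dS A p) (1 - g) `|g| D0 bD bL.
  apply: (sub_null _ (nullU nb (H _ _))).
  + move=> p /= gp; have [bp|bp] := eqVneq (b p) 0; first by left.
    by right; split => //; rewrite addrC.
  + by move=> p q; rewrite -mulrBr normrM ler_wpM2l// dS_lip.
  + by rewrite normr_ge0.
- have H := @null_level _ _ (bnd A) (dS A) (fun p => (1 - g) * b p) g `|1 - g| bndA
    (dS_norm A) (dS_lip A).
  apply: (sub_null _ (nullU na (H _ _))).
  + by move=> p /= gp; have [bp|bp] := eqVneq (dS A p) 0; [left|right].
  + by move=> p q; rewrite -mulrBr normrM ler_wpM2l.
  + by rewrite normr_ge0.
Qed.

Lemma davg_between N qsel A B (t : R) : bounded_set_e A -> A !=set0 -> null (bnd A) -> inJ B ->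
  B `<=` A -> 1 <= N -> 0 <= t <= 1 -> B = set0 \/ zmc A B ->
  (forall A : set V, (exists q, A q /\ forall p, A p -> dS A p <= dS A q) ->
     A (qsel A) /\ forall p, A p -> dS A p <= dS A (qsel A)) ->
  let g := xget 0 [set g : R | -N <= g <= N /\
     forall xi : R, -N <= xi <= N ->
       `|h qsel A B g - (t * mu A + (1 - t) * mu B)| <=
       `|h qsel A B xi - (t * mu A + (1 - t) * mu B)|] in
  avg_between t A B (ci (davg qsel A B g)).
Proof.
move=> bA A0 nA JB BA N1 t01 HB qselP; set tgt := t * _ + _; move=> g.
have bndA := bnd_neq0 bA A0; have bB := inJ_bounded JB.
have [b [[bE ba [D D0 bD] bL] [Bb nb nb0 [M bM] nhalf]]] :=
  davgfun_affine bA A0 nA JB BA qselP.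
(* Written as b + x (a - b) with a - b >= 0, the family increases in x and fits [lebo_level_ivt]. *)
pose S (x : R) := [set p | setT p /\ 0 <= b p + x * (dS A p - b p)].
have SE x : davg qsel A B x = S x.
  rewrite /davg; case: pselect => [AE|?] /=; first by case: A0 => z; rewrite AE.
  by apply/seteqP; split=> p /=; rewrite bE => H; [split=> //|case: H => _]; lra.
have fL x p q : `|(b p + x * (dS A p - b p)) - (b q + x * (dS A q - b q))| <=
    (`|x| + `|1 - x|) * enorm (p - q).
  rewrite (_ : _ - _ = x * (dS A p - dS A q) + (1 - x) * (b p - b q)); last by ring.
  apply: le_trans (ler_normD _ _) _; rewrite !normrM mulrDl.
  by rewrite lerD// ler_wpM2l// dS_lip.
have n0 (x : R) : null [set p | b p + x * (dS A p - b p) = 0].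
  have -> : [set p | b p + x * (dS A p - b p) = 0] =
      [set p | x * dS A p + (1 - x) * b p = 0].
    by apply/seteqP; split=> p /=; lra.
  have [->|x2] := eqVneq x 2^-1; last exact: (null_mix_level bndA nA D0).
  by have -> : 1 - 2^-1 = 2^-1 :> R by [lra]; exact: nhalf.
have nS (x : R) : null (bnd (S x)).
  apply: sub_null (n0 x).
  have -> : S x = [set p | 0 <= b p + x * (dS A p - b p)].
    by apply/seteqP; split=> p; [case|].
  exact: (bnd_level (fL x)).
have bS x : bounded_set_e (S x).
  have [MA AM] := bA; pose K := Num.max MA M.
  have KA : MA <= K by rewrite le_max lexx.
  have KM : M <= K by rewrite le_max lexx orbT.
  (* Beyond radius K both functions lie within K of - |p|, so the mixture is at most K - |p| + 2 K
     |x|. *)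
  exists (K + `|x| * (2 * K)) => p [_ Sp]; rewrite leNgt; apply/negP => H.
  have K0 : 0 <= K by have [z /AM zM] := A0; rewrite (le_trans _ KA)// (le_trans _ zM)// enorm_ge0.
  have Kp : K < enorm p by apply: le_lt_trans H; rewrite lerDl !mulr_ge0.
  have := dS_far AM bndA (le_lt_trans KA Kp); have := bM p (le_lt_trans KM Kp).
  move=> /andP[b1 b2] /andP[a1 a2].
  have : x * (dS A p - b p) <= `|x| * (2 * K).
    apply: le_trans (ler_norm _) _; rewrite normrM ler_wpM2l// ger0_norm ?subr_ge0//; lra.
  lra.
have Smono x y : x <= y -> S x `<=` S y.
  move=> xy p [_ xp]; split=> //; apply: le_trans xp _.
  by rewrite lerD2l ler_wpM2r// subr_ge0.
have mS x : lmeasurable (S x) by exact: bnd_lmeasurable.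
have BS0 : B `<=` S 0 by move=> p /Bb /= bp; split=> //; rewrite mul0r addr0.
have S0B : null (S 0 `\` B).
  by apply: sub_null nb => p [[_ Sp] Bp]; split=> //=; move: Sp; rewrite mul0r addr0.
have AS1 : A `<=` S 1 by move=> p /dS_in_ge0 ap; split=> //; move: ap; lra.
have S1A : null (S 1 `\` A).
  apply: sub_null nA => p [[_ Sp] Ap]; split; first by apply: dS_ge0 => //; move: Sp; lra.
  by move=> /interior_subset.
have muBA : mu B <= mu A.
  by rewrite -lee_fin -!lebo_mu//; exact: le_lebo.
case/andP: (t01) => t0 t1.
have S0E : lebo (S 0%R) = (mu B)%:E.
  rewrite -lebo_mu//; apply: eq_lebo_ae => //.
  by rewrite /null (_ : _ `\` _ = set0) ?lebo0//; apply/seteqP; split=> // p [/BS0].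
have S1E : lebo (S 1%R) = (mu A)%:E.
  rewrite -lebo_mu//; apply: eq_lebo_ae => //.
  by rewrite /null (_ : _ `\` _ = set0) ?lebo0//; apply/seteqP; split=> // p [/AS1].
have [x0 x01 x0E] : exists2 x : R, 0 <= x <= 1 & lebo (S x) = tgt%:E.
  apply: lebo_level_ivt => //.
  - by move=> p; rewrite subr_ge0.
  - by apply: bounded_lebo_lty; exact: (bS 1).
  - by move=> x _; exact: (mS x).
  - by move=> x _; apply: sub_null (n0 x) => p [].
  - change (lebo (S 0%R) <= tgt%:E <= lebo (S 1%R))%E.
    rewrite S0E S1E !lee_fin.
    have : 0 <= t * (mu A - mu B) by rewrite mulr_ge0// subr_ge0.
    have : 0 <= (1 - t) * (mu A - mu B) by rewrite mulr_ge0// subr_ge0.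
    by rewrite /tgt; lra.
have hx0 : h qsel A B x0 = tgt by rewrite /h SE /mu x0E.
(* As N >= 1, the exact solution x0 in [0, 1] competes in the minimization; hence the minimum is 0
   and g attains the target exactly. *)
have gE : lebo (S g) = tgt%:E.
  have [|_ /(_ x0)] := @xgetPex _ 0 [set g : R | -N <= g <= N /\
     forall xi : R, -N <= xi <= N -> `|h qsel A B g - tgt| <= `|h qsel A B xi - tgt|].
    by exists x0; split=> [|xi _]; [lra|rewrite hx0 subrr normr0].
  rewrite -/g hx0 subrr normr0 normr_le0 subr_eq0 => /(_ _)/eqP <-; last by lra.
  by rewrite /h SE lebo_mu.
have Sx0A : null (S x0 `\` A).
  by case/andP: x01 => _ x1; apply: sub_null S1A => p [/(Smono _ _ x1)].
have BSx0 : B `<=` S x0 by case/andP: x01 => x1 _ p /BS0/(Smono _ _ x1).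
have Soo x : (lebo (S x) < +oo)%E by exact: bounded_lebo_lty.
rewrite SE; apply: ci_between => //.
(* g and x0 may differ, but [S g] and [S x0] are nested with the same finite measure, so they differ
   by a null set and the inclusions known for x0 pass to g. *)
- case: (leP g x0) => gx.
    apply: (sub_null _ (null_diff (Smono _ _ gx) (mS g) (Soo g) _)); last by rewrite x0E.
    by move=> p [/BSx0].
  rewrite /null (_ : _ `\` _ = set0) ?lebo0//; apply/seteqP; split=> // p [/BSx0].
  by move/(Smono _ _ (ltW gx)).
- case: (leP g x0) => gx; first by apply: sub_null Sx0A => p [/(Smono _ _ gx)].
  have H := null_diff (Smono _ _ (ltW gx)) (mS x0) (Soo x0).
  apply: (sub_null _ (nullU (H _) Sx0A)); last by rewrite x0E.
  by move=> p [Sp Ap]; case: (pselect (S x0 p)) => Sx; [right|left].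
Qed.

Lemma Oball_between A B (t : R) : bounded_set_e A -> null (bnd A) -> inJ B -> B !=set0 ->
  B `<=` A -> 0 <= t <= 1 ->
  let r := xget 0 [set r : R | 0 <= r /\ mu (Oball B r `&` A) = t * mu A + (1 - t) * mu B] in
  avg_between t A B (ci (Oball B r `&` A)).
Proof.
move=> bA nA JB B0 BA t01; set tgt := t * _ + _; move=> r.
have bB := inJ_bounded JB; have cB := inJ_closed JB.
pose S (x : R) := [set p | A p /\ 0 <= - dist p B + x * 1].
have SE x : Oball B x `&` A = S x.
  rewrite setIC; apply/seteqP; split=> p [Ap xp]; split=> //.
    by move: xp; rewrite /Oball /= mulr1; lra.
  by move: xp; rewrite /Oball /= mulr1; lra.
have S0 : S 0 = B.
  apply/seteqP; split=> p; last by move=> Bp; split; [exact: BA|rewrite dist_in//; lra].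
  move=> [Ap p0]; apply: dist_eq0 => //; have := dist_ge0 p B; lra.
(* The level set of the distance to B at x > 0 falls under [null_level] with a constant [psi], so l
   = 0; x > 0 ensures that [phi] does not vanish on it. *)
have n0 (x : R) : 0 < x -> null [set p | - dist p B + x * 1 = 0].
  move=> x0; have H := @null_level R n' B (fun p => dist p B) (fun=> - x) 1 0 B0.
  apply: sub_null (H _ _ _ _).
  - move=> p /= px; have -> : dist p B = x by lra.
    by rewrite mul1r subrr gt_eqF.
  - by move=> p; rewrite ger0_norm// dist_ge0.
  - by move=> p q; exact: dist_lip.
  - by move=> p q; rewrite subrr normr0 mul0r.
  - by rewrite lexx normr1 ltr01.
have nS (x : R) : 0 <= x -> null (bnd (S x)).
  rewrite le_eqVlt => /orP[/eqP <-|x0]; first by rewrite S0; exact: inJ_bnd.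
  have -> : S x = A `&` [set p | 0 <= - dist p B + x * 1] by [].
  apply: sub_null (@bndI _ _ _ _) (nullU nA _); apply: sub_null (n0 x x0).
  apply: (@bnd_level _ 1) => p q; have := dist_lip p q B.
  by rewrite mul1r !ler_norml; lra.
have bS x : bounded_set_e (S x) by apply: sub_bounded bA => p [].
have muBA : mu B <= mu A by rewrite -lee_fin -!lebo_mu//; exact: le_lebo.
case/andP: (t01) => t0 t1; have [MA AM] := bA.
have [X X0 XA] : exists2 X : R, 0 <= X & S X = A.
  have [z Bz] := B0; have zM := AM z (BA z Bz); have z0 := enorm_ge0 z.
  (* Twice the norm bound of A bounds its diameter, so at this radius the neighbourhood of B
     contains A. *)
  exists (2 * MA); first by lra.
  apply/seteqP; split=> [p []//|p Ap]; split=> //.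
  have := dist_le p Bz; have := enormD p (- z); rewrite enormN; have := AM p Ap; lra.
have [x0 x0X x0E] : exists2 x : R, 0 <= x <= X & lebo (S x) = tgt%:E.
  apply: lebo_level_ivt => //.
  - by apply: bounded_lebo_lty; exact: (bS X).
  - by move=> x /andP[x0 _]; exact/bnd_lmeasurable/nS.
  - by move=> x /andP[x0 _]; apply: sub_null (n0 x x0) => p [].
  - change (lebo (S 0%R) <= tgt%:E <= lebo (S X))%E; rewrite S0 XA !lebo_mu// !lee_fin.
    have : 0 <= t * (mu A - mu B) by rewrite mulr_ge0// subr_ge0.
    have : 0 <= (1 - t) * (mu A - mu B) by rewrite mulr_ge0// subr_ge0.
    by rewrite /tgt; lra.
have [|r0 rE] := @xgetPex _ 0 [set r : R | 0 <= r /\ mu (Oball B r `&` A) = tgt].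
  by exists x0; case/andP: x0X => x00 _; split=> //; rewrite SE /mu x0E.
have r00 : 0 <= r := r0; rewrite -/r SE in rE; rewrite SE; apply: ci_between => //.
- by apply: nS.
- rewrite /null (_ : _ `\` _ = set0) ?lebo0//; apply/seteqP; split=> // p [Bp]; apply.
  by split; [exact: BA|rewrite dist_in//; lra].
- by rewrite /null (_ : _ `\` _ = set0) ?lebo0//; apply/seteqP; split=> // p [[]].
- by rewrite lebo_mu// rE.
Qed.

(* A need not be regular closed: when A \ B has infinitely many components, neither the
   large components nor the merged remainder give regular closed sets together with B. *)
Lemma avg1_between N qsel A B (t : R) : bounded_set_e A -> null (bnd A) -> inJ B ->
  B `<=` A -> 1 <= N -> 0 <= t <= 1 ->
  (forall A : set V, (exists q, A q /\ forall p, A p -> dS A p <= dS A q) ->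
     A (qsel A) /\ forall p, A p -> dS A p <= dS A (qsel A)) ->
  avg_between t A B (avg1 N qsel A B t).
Proof.
move=> bA nA JB BA N1 t01 qselP; rewrite /avg1.
case: pselect => [AB|AB] /=.
  have nAA : null (B `\` B) by rewrite setDv; exact: null0.
  rewrite AB; split=> //; rewrite (lebo_mu (inJ_bounded JB)); congr (_%:E); lra.
have A0 : A !=set0.
  apply/set0P/eqP => AE; apply: AB; rewrite AE; apply/seteqP; split=> // p /BA.
  by rewrite AE.
case: pselect => [HB|HB] /=; last first.
  apply: Oball_between => //; apply/set0P/eqP => BE; apply: HB; by left.
have {}HB : B = set0 \/ zmc A B by case: HB => [|[]]; [left|right|].
exact: davg_between.
Qed.

End SimpleAverage.

(** * Averages of nested pairs and of general pairs *)

Section NestedAverage.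
Variables (R : realType) (n' : nat).
Local Notation n := n'.+1.
Local Notation V := 'rV[R]_n.
Local Notation lebo := (@lebo R n).
Implicit Types (p q u v w : V) (A B C E F X : set V).

Definition good E := bounded_set_e E /\ lmeasurable E.

Lemma inJ_good A : inJ A -> good A.
Proof. by move=> JA; split; [exact: inJ_bounded|exact: inJ_lmeasurable]. Qed.

Lemma goodU E F : good E -> good F -> good (E `|` F).
Proof.
by move=> [bE mE] [bF mF]; split; [exact: boundedU|exact: caratheodory_measurable_setU].
Qed.

Lemma goodI E F : good E -> good F -> good (E `&` F).
Proof.
move=> [bE mE] [bF mF]; split; last exact: caratheodory_measurable_setI.
by apply: sub_bounded bE; exact: subIsetl.
Qed.

Lemma goodD E F : good E -> good F -> good (E `\` F).
Proof.
move=> [bE mE] [bF mF]; split; last exact: caratheodory_measurable_setD.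
by apply: sub_bounded bE; exact: subDsetl.
Qed.

Lemma mu_split E F : good E -> good F -> mu E = mu (E `&` F) + mu (E `\` F).
Proof.
move=> gE gF; apply/EFin_inj; rewrite EFinD -!lebo_mu; [|by case: (goodD gE gF)|
  by case: (goodI gE gF)|by case: gE].
by apply: lebo_split; case: gF.
Qed.

Lemma mu_null E : null E -> mu E = 0. Proof. by rewrite /mu => ->. Qed.

Lemma eq_mu_ae E F : null (E `\` F) -> null (F `\` E) -> mu E = mu F.
Proof. by move=> EF FE; rewrite /mu (eq_lebo_ae EF FE). Qed.

Lemma le_mu_ae E F : good F -> null (E `\` F) -> bounded_set_e E -> mu E <= mu F.
Proof. by move=> [bF _] EF bE; rewrite -lee_fin -!lebo_mu//; exact: le_lebo_ae. Qed.

Lemma mu_D E F : good E -> good F -> null (F `\` E) -> mu (E `\` F) = mu E - mu F.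
Proof.
move=> gE gF FE; have := mu_split gE gF; have -> : mu (E `&` F) = mu F.
  apply: eq_mu_ae.
    by rewrite /null (_ : _ `\` _ = set0) ?lebo0//; apply/seteqP; split=> // p [[]].
  by apply: sub_null FE => p [Fp NEF]; split=> // Ep; apply: NEF.
by move=> ->; rewrite addrAC subrr add0r.
Qed.

Lemma mu_UI E F : good E -> good F -> mu (E `|` F) + mu (E `&` F) = mu E + mu F.
Proof.
move=> gE gF; rewrite (mu_split (goodU gE gF) gE) (mu_split gF gE).
have -> : (E `|` F) `&` E = E by apply/seteqP; split=> [p []|p Ep]//; split=> //; left.
have -> : (E `|` F) `\` E = F `\` E.
  by apply/seteqP; split=> [p [[]]|p []]//; move=> Fp NEp; split=> //; right.
by rewrite (setIC F E); ring.
Qed.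

(** These are the unions of connected components of A \ B, which treats single components and the
    merged remainder alike. *)
Definition saturated A B E := E `<=` A `\` B /\
  forall x, E x -> connected_component (A `\` B) x `<=` E.

Lemma ball_component D p e : (forall q, enorm (p - q) < e -> D q) ->
  forall q r, enorm (p - q) < e -> enorm (p - r) < e -> connected_component D q r.
Proof.
move=> eD.
have H q : enorm (p - q) < e -> connected_component D p q.
  move=> pq; exists (segment p q); last exact: segment1.
  split; [exact: segment0| |exact: segment_connected].
  move=> z /segmentP pz; apply: eD; apply: le_lt_trans pq.
  by rewrite -pz lerDl enorm_ge0.
move=> q r /H pq /H pr; apply: connected_component_trans pr.
exact: connected_component_sym.
Qed.

(** Off both boundaries a limit point of B [|] E that is not interior to it has a ball inside A \ B.
    That ball lies in one component, so meeting E it lies in E, and the point is interior after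
    all. *)
Lemma bnd_saturated A B E : closed A -> closed B -> B `<=` A -> saturated A B E ->
  bnd (B `|` E) `<=` bnd A `|` bnd B.
Proof.
move=> cA cB BA [EAB sE] p [cp ip].
have BEA : B `|` E `<=` A by move=> q [/BA|/EAB[]].
case: (pselect (bnd A p)) => bAp; first by left.
case: (pselect (bnd B p)) => bBp; first by right.
exfalso; apply: (ip).
have Ap : interior A p.
  by apply: contrapT => iA; apply: bAp; split=> //; exact: (closureS BEA).
have Bp : ~ B p.
  move=> Bp; apply: bBp; split; first exact: subset_closure.
  by move=> iB; apply: ip; apply: interiorS iB; exact: subsetUl.
have : interior (A `&` ~` B) p.
  rewrite interiorI; split=> //; rewrite (interior_id (~` B)).1//.
  exact: closed_openC.
move=> /interior_enormP[e e0 eAB].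
have [q BEq pq] := (closure_enormP _ _).1 cp e e0.
have Eq : E q by case: BEq => // Bq; have [_] := eAB q pq.
apply/interior_enormP; exists e => // r pr; right.
by apply: (sE q Eq); apply: (ball_component eAB).
Qed.

Lemma component_saturated A B C : components (A `\` B) C -> saturated A B C.
Proof.
move=> [x ABx <-]; split; first exact: connected_component_sub.
move=> y xy z yz; exact: connected_component_trans xy yz.
Qed.

Lemma component_eq D C C' : components D C -> components D C' -> C `&` C' !=set0 -> C = C'.
Proof.
move=> [x Dx <-] [y Dy <-] [z [xz yz]].
by rewrite (same_connected_component xz) (same_connected_component yz).
Qed.

Lemma saturated_good A B E : inJ A -> inJ B -> B `<=` A -> saturated A B E ->
  [/\ good E, bounded_set_e (B `|` E) & null (bnd (B `|` E))].
Proof.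
move=> JA JB BA sE; have EAB := sE.1.
have bBE : bounded_set_e (B `|` E).
  by apply: sub_bounded (inJ_bounded JA) => p [/BA|/EAB[]].
have nBE : null (bnd (B `|` E)).
  apply: sub_null (bnd_saturated (inJ_closed JA) (inJ_closed JB) BA sE) _.
  by apply: nullU; exact: inJ_bnd.
split=> //; have -> : E = (B `|` E) `\` B.
  by apply/seteqP; split=> [p Ep|p [[]]//]; split; [right|case: (EAB p Ep)].
by apply: goodD; [split=> //; exact: bnd_lmeasurable|exact: inJ_good].
Qed.

Lemma finite_big_components A B (eps : R) : inJ A -> inJ B -> B `<=` A -> 0 < eps ->
  finite_set [set C | components (A `\` B) C /\ (eps%:E <= lebo C)%E].
Proof.
move=> JA JB BA e0; set S := [set C | _]; apply: contrapT => /infiniteP/pcard_leP[f].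
have fS k : S (f k) by exact: funS.
have mf k : lmeasurable (f k).
  by have [/component_saturated/(saturated_good JA JB BA)[[]]] := fS k.
have tf : trivIset setT (fun k => f k).
  apply/trivIsetP => i j _ _ ij; apply/seteqP; split=> // z fz.
  have := component_eq (fS i).1 (fS j).1 (ex_intro _ z fz).
  move=> fij; have ijE : i = j by apply: (@inj _ _ _ f) => //; rewrite ?in_setT.
  by move: ij; rewrite ijE eqxx.
have bA := inJ_bounded JA.
pose m := (Num.truncn (mu A / eps)).+1.
have H := caratheodory_additive mf tf m A.
have : (\sum_(i < m) lebo (A `&` f i) <= lebo A)%E.
  by rewrite -H; apply: le_lebo; exact: subIsetl.
apply/negP; rewrite -ltNge lebo_mu//.
apply: (@lt_le_trans _ _ (\sum_(i < m) eps%:E)%E).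
  rewrite sumEFin lte_fin sumr_const card_ord -mulr_natl -ltr_pdivrMr//.
  exact: truncnS_gt.
apply: lee_sum => i _; rewrite (_ : A `&` f i = f i); first by have [] := fS i.
by apply/setIidr => z; have [/component_saturated[H' _] _] := fS i; move=> /H'[].
Qed.

Lemma comps_spec (eps : R) A B : inJ A -> inJ B -> B `<=` A -> 0 < eps ->
  [/\ finite_set (comps eps A B),
      forall C, comps eps A B C -> saturated A B C,
      forall C C', comps eps A B C -> comps eps A B C' -> C `&` C' !=set0 -> C = C' &
      \bigcup_(C in comps eps A B) C = A `\` B].
Proof.
move=> JA JB BA e0; rewrite /comps; case: pselect => [fin|infin] /=.
  split=> //.
  - exact: component_saturated.
  - exact: component_eq.
  - apply/seteqP; split=> [p [C [x _ <-]]|p ABp]; first exact: connected_component_sub.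
    exists (connected_component (A `\` B) p); first by exists p.
    exact: connected_component_refl.
have cU : saturated A B (\bigcup_(C in [set C | components (A `\` B) C /\
    (lebo C < eps%:E)%E]) C).
  split=> [p [C [cC _] Cp]|p [C [cC lC] Cp]]; first exact: (component_saturated cC).1.
  by move=> q pq; exists C => //; exact: (component_saturated cC).2 pq.
have disj C q : components (A `\` B) C -> (eps%:E <= lebo C)%E -> C q ->
    ~ (\bigcup_(C in [set C | components (A `\` B) C /\ (lebo C < eps%:E)%E]) C) q.
  move=> cC lC Cq [C' [cC' lC'] C'q].
  have CC' := component_eq cC cC' (ex_intro _ q (conj Cq C'q)).
  by move: lC'; rewrite -CC' ltNge lC.
split.
- by rewrite finite_setU; split; [exact: finite_big_components|exact: finite_set1].
- by move=> C [[/component_saturated//]|-> //].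
- move=> C C' [[cC lC]|->] [[cC' lC']|->] => [|[q [Cq Uq]]|[q [Uq Cq]]|//].
  + exact: (component_eq cC cC').
  + by have := disj C q cC lC Cq.
  + by have := disj C' q cC' lC' Cq.
- apply/seteqP; split=> [p [C [[/component_saturated[CAB _] _]|->]]|p ABp].
  + exact: CAB.
  + exact: cU.1.
  have cp : components (A `\` B) (connected_component (A `\` B) p) by exists p.
  have pp := connected_component_refl ABp.
  have [lp|lp] := leP eps%:E (lebo (connected_component (A `\` B) p)).
    by exists (connected_component (A `\` B) p) => //; left.
  by eexists; [right; reflexivity|]; exists (connected_component (A `\` B) p).
Qed.

Lemma between_refl (t : R) A : inJ A -> avg_between t A A A.
Proof.
move=> JA; have nAA : null (A `\` A) by rewrite setDv; exact: lebo0.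
by split=> //; rewrite (lebo_mu (inJ_bounded JA)); congr (_%:E); lra.
Qed.

Lemma between_mu (t : R) A B E : avg_between t A B E -> mu E = t * mu A + (1 - t) * mu B.
Proof. by move=> [_ _ _ lE]; rewrite /mu lE. Qed.

(** Each Ei lies between B and B [|] Ci, and C1, C2 are disjoint, so E1 and E2 meet in B up to a
    null set. Inclusion-exclusion then makes the measures combine affinely. *)
Lemma betweenU (t : R) B C1 C2 E1 E2 : inJ B -> good C1 -> good C2 ->
  C1 `&` C2 = set0 -> avg_between t (B `|` C1) B E1 -> avg_between t (B `|` C2) B E2 ->
  avg_between t (B `|` (C1 `|` C2)) B (E1 `|` E2).
Proof.
move=> JB gC1 gC2 C12 bt1 bt2; have m1 := between_mu bt1; have m2 := between_mu bt2.
have [J1 n1 n1' _] := bt1; have [J2 n2 n2' _] := bt2.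
have gB := inJ_good JB; have g1 := inJ_good J1; have g2 := inJ_good J2.
split.
- exact: inJU.
- by apply: sub_null n1 => p [Bp NE]; split=> // E1p; apply: NE; left.
- apply: sub_null (nullU n1' n2') => p [[E1p|E2p] NBC]; [left|right]; split=> //.
    by case=> ?; apply: NBC; [left|right; left].
  by case=> ?; apply: NBC; [left|right; right].
- rewrite lebo_mu; last by apply: inJ_bounded; exact: inJU.
  congr (_%:E).
  have H1 := mu_UI g1 g2; have H2 := mu_UI (goodU gB gC1) (goodU gB gC2).
  have BE : (B `|` C1) `&` (B `|` C2) = B.
    rewrite -setUIr C12 setU0//.
  have BC : (B `|` C1) `|` (B `|` C2) = B `|` (C1 `|` C2) by rewrite setUACA setUid.
  rewrite BE BC in H2.
  have E12 : mu (E1 `&` E2) = mu B.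
    apply: eq_mu_ae.
      apply: sub_null (nullU n1' n2') => p [[E1p E2p] NB].
      case: (pselect (C1 p)) => C1p; last by left; split=> //; case.
      right; split=> //; case=> // C2p.
      by have : (C1 `&` C2) p by []; rewrite C12.
    apply: sub_null (nullU n1 n2) => p [Bp NE].
    by case: (pselect (E1 p)) => E1p; [right|left]; split=> // E2p; apply: NE.
  have -> : mu (B `|` (C1 `|` C2)) = mu (B `|` C1) + mu (B `|` C2) - mu B by lra.
  have -> : mu (E1 `|` E2) = mu E1 + mu E2 - mu B by lra.
  by rewrite m1 m2; ring.
Qed.

Lemma avg2_between N (eps : R) qsel A B (t : R) : inJ A -> inJ B -> B `<=` A ->
  1 <= N -> 0 < eps -> 0 <= t <= 1 ->
  (forall A : set V, (exists q, A q /\ forall p, A p -> dS A p <= dS A q) ->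
     A (qsel A) /\ forall p, A p -> dS A p <= dS A (qsel A)) ->
  avg_between t A B (avg2 N eps qsel A B t).
Proof.
move=> JA JB BA N1 e0 t01 qselP; rewrite /avg2.
case: pselect => [AB|AB] /=; first by rewrite -AB; exact: between_refl.
case: pselect => [t0|[]] /=; last by case/andP: t01.
have [fin sat disj cov] := comps_spec JA JB BA e0.
pose G C := avg1 N qsel (B `|` C) B t.
have GP C : comps eps A B C -> avg_between t (B `|` C) B (G C).
  move=> /sat /(saturated_good JA JB BA)[_ bBC nBC]; exact: avg1_between.
have /finite_seqP[s sE] := fin.
have consE (C : set V) (r : seq (set V)) : [set` C :: r] = C |` [set` r].
  apply/seteqP; split=> x /=; rewrite inE; first by move=> /orP[/eqP|]; [left|right].
  by move=> [->|->]; rewrite ?eqxx ?orbT.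
(* B is joined to the union of the averages so that the empty list yields B and the induction can
   start. *)
have key (r : seq (set V)) : uniq r -> {subset r <= s} ->
    good (\bigcup_(C in [set` r]) C) /\
    avg_between t (B `|` \bigcup_(C in [set` r]) C) B (B `|` \bigcup_(C in [set` r]) G C).
  elim: r => [_ _|C r IH /= /andP[Cr ur] rs].
    rewrite set_nil !bigcup_set0 !setU0; split; last exact: between_refl.
    exact/inJ_good/inJ0.
  have [|gr br] := IH ur; first by move=> x xr; apply: rs; rewrite inE xr orbT.
  have cC : comps eps A B C by rewrite sE /=; apply: rs; rewrite inE eqxx.
  have [gC _ _] := saturated_good JA JB BA (sat C cC).
  rewrite consE !bigcup_setU1; split; first exact: goodU.
  rewrite [X in avg_between _ _ _ X]setUCA; apply: betweenU => //; last exact: GP.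
  apply/seteqP; split=> // p [Cp [C' /= C'r C'p]].
  have cC' : comps eps A B C' by rewrite sE /=; apply: rs; rewrite inE C'r orbT.
  have CC' := disj C C' cC cC' (ex_intro _ p (conj Cp C'p)).
  by move: Cr; rewrite CC' C'r.
have [|_] := key (undup s) (undup_uniq s); first by move=> x; rewrite mem_undup.
have -> : [set` undup s] = comps eps A B.
  by rewrite sE; apply/seteqP; split=> x /=; rewrite mem_undup.
rewrite cov (_ : B `|` A `\` B = A); last first.
  apply/seteqP; split=> [p [/BA|[]]//|p Ap].
  by case: (pselect (B p)) => Bp; [left|right].
set W := \bigcup_(C in _) _.
(* [key] shows that B [|] W is in the class, not W itself; W gets its own induction, and B is
   absorbed into W up to a null set because there is at least one component. *)
have JW : inJ W.
  have -> : W = \bigcup_(C in [set` s]) G C by rewrite -sE.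
  have : {subset s <= s} by [].
  elim: {1 3}s => [_|C r IH rs]; first by rewrite set_nil bigcup_set0; exact: inJ0.
  rewrite consE bigcup_setU1; apply: inJU.
    have cC : comps eps A B C by rewrite sE /=; apply: rs; rewrite inE eqxx.
    by have [] := GP C cC.
  by apply: IH => x xr; apply: rs; rewrite inE xr orbT.
have nBW : null (B `\` W).
  have [x ABx] : A `\` B !=set0.
    apply: contrapT => H; apply: AB; apply/seteqP; split=> // p Ap.
    by apply: contrapT => Bp; apply: H; exists p.
  move: ABx; rewrite -cov => -[C cC _]; have [_ n1 _ _] := GP C cC.
  by apply: sub_null n1 => p [Bp NW]; split=> // Gp; apply: NW; exists C.
move=> [_ _ nWA lW]; split=> //.
  by apply: sub_null nWA => p [Wp]; split=> //; right.
rewrite -lW; apply: eq_lebo_ae; last by apply: sub_null nBW => p [[]].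
by rewrite /null (_ : _ `\` _ = set0) ?lebo0//; apply/seteqP; split=> // p [Wp]; case; right.
Qed.

Lemma dmuE A B : inJ A -> inJ B -> dmu A B = (mu (A `\` B) + mu (B `\` A))%:E.
Proof.
move=> JA JB; have gA := inJ_good JA; have gB := inJ_good JB.
have gAB := goodD gA gB; have gBA := goodD gB gA.
rewrite /dmu lebo_mu; last by case: (goodU gAB gBA).
congr (_%:E); have := mu_UI gAB gBA.
rewrite (_ : _ `&` _ = set0); last by apply/seteqP; split=> // p [[? ?] []].
by rewrite (mu_null (lebo0 _ _)) addr0.
Qed.

(** Up to null sets I is the intersection of A and B. The average misses at most A \ R1, of measure
    (1 - t)(mu A - mu I), and exceeds A at most in R2 \ I, of measure (1 - t)(mu B - mu I); the sum
    is (1 - t) d(A, B). The estimate for B is symmetric. *)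
Lemma mavg_spec N (eps : R) qsel A B (t : R) : inJ A -> inJ B ->
  1 <= N -> 0 < eps -> 0 <= t <= 1 ->
  (forall A : set V, (exists q, A q /\ forall p, A p -> dS A p <= dS A q) ->
     A (qsel A) /\ forall p, A p -> dS A p <= dS A (qsel A)) ->
  let M := mavg N eps qsel A B t in
  [/\ inJ M, (dmu M A <= (1 - t)%:E * dmu A B)%E & (dmu M B <= t%:E * dmu A B)%E].
Proof.
move=> JA JB N1 e0 t01 qselP M.
have dAA A' : dmu A' A' = 0%E by rewrite /dmu !setDv setU0 lebo0.
move: @M; rewrite /mavg; case: pselect => [AB|AB] /=.
  by split=> //; rewrite -AB dAA mule0.
case: pselect => [t01'|[]//] /=.
set I := ci (A `&` B).
have gA := inJ_good JA; have gB := inJ_good JB.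
have nAB : null (bnd (A `&` B)).
  by apply: sub_null (@bndI _ _ A B) _; apply: nullU; exact: inJ_bnd.
have bAB : bounded_set_e (A `&` B) by case: (goodI gA gB).
have JI : inJ I by exact: ci_inJ.
have gI := inJ_good JI.
have IAB : I `<=` A `&` B.
  move=> p /ci_sub_closure; rewrite -(closure_id (A `&` B)).1//.
  by apply: closedI; exact: inJ_closed.
have IA : I `<=` A by move=> p /IAB[].
have IB : I `<=` B by move=> p /IAB[].
have muI : mu I = mu (A `&` B) by have [n1 n2] := ci_ae nAB; exact: eq_mu_ae.
have n0 E F : E `<=` F -> null (E `\` F).
  by move=> EF; rewrite /null (_ : _ `\` _ = set0) ?lebo0//; apply/seteqP; split=> // p [/EF].
have t01'' : 0 <= 1 - t <= 1 by lra.
have b1 := @avg2_between N eps qsel A I t JA JI IA N1 e0 t01 qselP.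
have b2 := @avg2_between N eps qsel B I (1 - t) JB JI IB N1 e0 t01'' qselP.
set R1 := avg2 _ _ _ A _ _ in b1 *; set R2 := avg2 _ _ _ B _ _ in b2 *.
have m1 := between_mu b1; have m2 := between_mu b2.
have [J1 IR1 R1A _] := b1; have [J2 IR2 R2B _] := b2.
have JM : inJ (R1 `|` R2) by exact: inJU.
have g1 := inJ_good J1; have g2 := inJ_good J2; have gM := inJ_good JM.
split=> //; rewrite !dmuE// -EFinM lee_fin.
- have h1 : mu (A `\` (R1 `|` R2)) <= mu (A `\` R1).
    apply: le_mu_ae; [exact: goodD| |by case: (goodD gA gM)].
    by apply: n0 => p [Ap NR]; split=> // R1p; apply: NR; left.
  have h2 : mu ((R1 `|` R2) `\` A) <= mu (R2 `\` I).
    apply: le_mu_ae; [exact: goodD| |by case: (goodD gM gA)].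
    apply: sub_null R1A => p [[[R1p|R2p] NA] NI]; first by [].
    by exfalso; apply: NI; split=> // /IA.
  have e1 := mu_D gA g1 R1A; have e2 := mu_D g2 gI IR2.
  have e3 := mu_split gA gB; have e4 := mu_split gB gA; rewrite setIC in e4.
  have -> : mu (A `\` B) = mu A - mu I by lra.
  have -> : mu (B `\` A) = mu B - mu I by lra.
  rewrite e1 m1 in h1; rewrite e2 m2 in h2; lra.
- have h1 : mu (B `\` (R1 `|` R2)) <= mu (B `\` R2).
    apply: le_mu_ae; [exact: goodD| |by case: (goodD gB gM)].
    by apply: n0 => p [Ap NR]; split=> // R1p; apply: NR; right.
  have h2 : mu ((R1 `|` R2) `\` B) <= mu (R1 `\` I).
    apply: le_mu_ae; [exact: goodD| |by case: (goodD gM gB)].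
    apply: sub_null R2B => p [[[R1p|R2p] NA] NI]; last by [].
    by exfalso; apply: NI; split=> // /IB.
  have e1 := mu_D gB g2 R2B; have e2 := mu_D g1 gI IR1.
  have e3 := mu_split gA gB; have e4 := mu_split gB gA; rewrite setIC in e4.
  have -> : mu (A `\` B) = mu A - mu I by lra.
  have -> : mu (B `\` A) = mu B - mu I by lra.
  rewrite e1 m2 in h1; rewrite e2 m1 in h2; lra.
Qed.

End NestedAverage.

(** * The subdivision scheme and its limit *)

Lemma floor_double (R : realType) (x : R) :
  (`|(2 * Num.floor x - Num.floor (2 * x))%R|%N <= 1)%N.
Proof.
have /andP[i1 i2] := floor_itv x; have /andP[j1 j2] := floor_itv (2 * x).
move: (Num.floor x) (Num.floor (2 * x)) i1 i2 j1 j2 => i j i1 i2 j1 j2.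
have a1 : (2 * i < j + 1)%R by rewrite -(ltr_int R) intrM; lra.
have a2 : (j < 2 * (i + 1))%R by rewrite -(ltr_int R) intrM; lra.
lia.
Qed.

Lemma floor_dist (R : realType) (x y : R) :
  (`|(Num.floor x - Num.floor y)%R|%N)%:R <= `|x - y| + 1.
Proof.
have /andP[i1 i2] := floor_itv x; have /andP[j1 j2] := floor_itv y.
rewrite intrD in i2; rewrite intrD in j2.
rewrite natr_absz intr_norm intrD mulrNz.
have := ler_norm (x - y); have := ler_norm (- (x - y)).
rewrite normrN ler_norml; lra.
Qed.

(** A point whose membership never changes after stage k belongs to both E k and the lower limit, or
    to neither. So the distance to the limit is bounded by the sum of the later steps. *)
Lemma liminf_setD T (E : nat -> set T) k (S := \bigcup_k \bigcap_j E (k + j)%N) :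
  (E k `\` S) `|` (S `\` E k) `<=` \bigcup_j ((E (k + j)%N `\` E (k + j.+1)%N) `|`
    (E (k + j.+1)%N `\` E (k + j)%N)).
Proof.
move=> p pE; apply: contrapT => ND.
have st j : E (k + j)%N p <-> E k p.
  elim: j => [|j IH]; first by rewrite addn0.
  rewrite -IH; split=> H; apply: contrapT => H'; apply: ND; exists j => //.
    by right; split.
  by left; split.
case: pE => [[kp Np]|[[l _ lp] Nk]].
  by apply: Np; exists k => // j _; apply/st.
by apply: Nk; apply/(st l); rewrite addnC; exact: lp.
Qed.

Section Scheme.
Variables (R : realType) (n' : nat).
Local Notation n := n'.+1.
Local Notation V := 'rV[R]_n.
Local Notation lebo := (@lebo R n).
Implicit Types (p q u v w : V) (A B C E X : set V) (c : R).

Lemma dmu_ge0 A B : (0 <= dmu A B)%E. Proof. exact: lebo_ge0. Qed.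

Lemma dmuC A B : dmu A B = dmu B A. Proof. by rewrite /dmu setUC. Qed.

Lemma dmuxx A : dmu A A = 0%E. Proof. by rewrite /dmu setDv setU0 lebo0. Qed.

Lemma dmu_triangle B A C : (dmu A C <= dmu A B + dmu B C)%E.
Proof.
apply: le_trans (lebo_subU _ _); apply: le_lebo => p [[Ap Cp]|[Cp Ap]].
  by case: (pselect (B p)) => Bp; [right; left|left; left].
by case: (pselect (B p)) => Bp; [left; right|right; right].
Qed.

Lemma dmu_triangle_le B A C (a b : R) : (dmu A B <= a%:E)%E -> (dmu B C <= b%:E)%E ->
  (dmu A C <= (a + b)%:E)%E.
Proof. by move=> H1 H2; apply: le_trans (dmu_triangle B A C) _; rewrite EFinD leeD. Qed.

Variables (N eps : R) (qsel : set V -> V).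
Hypotheses (N1 : 1 <= N) (e0 : 0 < eps).
Hypothesis qselP : forall A : set V, (exists q, A q /\ forall p, A p -> dS A p <= dS A q) ->
     A (qsel A) /\ forall p, A p -> dS A p <= dS A (qsel A).
Local Notation mavg := (mavg N eps qsel).

Lemma mavg_inJ A B t : inJ A -> inJ B -> 0 <= t <= 1 -> inJ (mavg A B t).
Proof. by move=> JA JB t01; have [] := mavg_spec JA JB N1 e0 t01 qselP. Qed.

Lemma mavg_dist A B t c : inJ A -> inJ B -> 0 <= t <= 1 -> (dmu A B <= c%:E)%E ->
  (dmu (mavg A B t) A <= ((1 - t) * c)%:E)%E /\ (dmu (mavg A B t) B <= (t * c)%:E)%E.
Proof.
move=> JA JB t01 ABc; have [_ H1 H2] := mavg_spec JA JB N1 e0 t01 qselP.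
have /andP[t0 t1] := t01; split.
  by apply: le_trans H1 _; rewrite EFinM lee_wpmul2l// lee_fin subr_ge0.
by apply: le_trans H2 _; rewrite EFinM lee_wpmul2l// lee_fin.
Qed.

Lemma half01 : 0 <= (2^-1 : R) <= 1. Proof. lra. Qed.

Definition steps_le (F : int -> set V) c :=
  (forall i, inJ (F i)) /\ forall i, (dmu (F i) (F (i + 1)%R) <= c%:E)%E.

Lemma steps_le_dist F c i (k : nat) : steps_le F c ->
  (dmu (F i) (F (i + k%:Z)%R) <= (k%:R * c)%:E)%E.
Proof.
move=> [_ Fc]; elim: k => [|k IH]; first by rewrite addr0 mul0r dmuxx.
rewrite -(natr1 k) mulrDl mul1r; apply: (dmu_triangle_le IH).
by rewrite (_ : i + k.+1%:Z = i + k%:Z + 1)//; lia.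
Qed.

Lemma steps_le_absz F c i j : steps_le F c ->
  (dmu (F i) (F j) <= ((`|i - j|%N)%:R * c)%:E)%E.
Proof.
move=> Fc; have [ij|ij] := leP i j.
  by have := steps_le_dist i (`|i - j|%N) Fc; rewrite (_ : i + _ = j)//; lia.
by have := steps_le_dist j (`|i - j|%N) Fc; rewrite dmuC (_ : j + _ = i)//; lia.
Qed.

Definition smooth (G : int -> set V) (i : int) : set V := mavg (G i) (G (i + 1)) (2^-1).

Definition refine (F : int -> set V) (i : int) : set V :=
  if i \in dvdz 2 then F (divz i 2)
  else mavg (F (divz i 2)) (F (divz i 2 + 1)) (2^-1).

(** Consecutive averages share the neighbour G (i + 1), and each is within c / 2 of it. *)
Lemma smooth_steps G c : steps_le G c -> steps_le (smooth G) c.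
Proof.
move=> [JG Gc]; split=> [i|i]; first by apply: mavg_inJ => //; exact: half01.
have [_ H1] := mavg_dist (JG i) (JG (i + 1)) half01 (Gc i).
have [H2 _] := mavg_dist (JG (i + 1)) (JG (i + 1 + 1)) half01 (Gc (i + 1)).
rewrite dmuC in H2; have := dmu_triangle_le H1 H2.
by rewrite (_ : _ + _ = c)//; lra.
Qed.

Lemma iter_smooth_steps G c j : steps_le G c -> steps_le (iter j smooth G) c.
Proof. by move=> Gc; elim: j => // j IH; exact: smooth_steps. Qed.

Lemma iter_smooth_dist G c j i : steps_le G c ->
  (dmu (iter j smooth G i) (G i) <= (j%:R * c)%:E)%E.
Proof.
move=> Gc; elim: j => [|j IH]; first by rewrite mul0r dmuxx.
have [Jj cj] := iter_smooth_steps j Gc.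
have [H1 _] := mavg_dist (Jj i) (Jj (i + 1)) half01 (cj i).
have c0 : 0 <= c by rewrite -lee_fin; apply: le_trans (cj i); exact: dmu_ge0.
apply: le_trans (dmu_triangle_le H1 IH) _; rewrite lee_fin -(natr1 j) [leRHS]mulrDl; lra.
Qed.

Lemma refine_even F (q : int) : refine F (2 * q) = F q.
Proof. by rewrite /refine ifT ?mulKz//; apply/dvdzP; exists q; rewrite mulrC. Qed.

Lemma refine_odd F (q : int) : refine F (2 * q + 1) = mavg (F q) (F (q + 1)) (2^-1).
Proof.
rewrite /refine ifF; last by apply/negP => /dvdzP[r]; lia.
by rewrite (_ : divz (2 * q + 1) 2 = q)//; lia.
Qed.

Lemma int_parity (i : int) : exists q : int, i = 2 * q \/ i = 2 * q + 1.
Proof. exists (divz i 2); lia. Qed.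

Lemma refine_steps F c : steps_le F c -> steps_le (refine F) (c / 2).
Proof.
move=> [JF Fc]; split=> i; have [q [->|->]] := int_parity i.
- by rewrite refine_even.
- by rewrite refine_odd; apply: mavg_inJ => //; exact: half01.
- have [H _] := mavg_dist (JF q) (JF (q + 1)) half01 (Fc q).
  rewrite refine_even refine_odd dmuC; apply: le_trans H _; rewrite lee_fin; lra.
- have [_ H] := mavg_dist (JF q) (JF (q + 1)) half01 (Fc q).
  rewrite refine_odd (_ : 2 * q + 1 + 1 = 2 * (q + 1)) ?refine_even; last by lia.
  apply: le_trans H _; rewrite lee_fin; lra.
Qed.

Lemma spline_stepE m F i :
  spline_step N eps qsel m F i = iter m.-1 smooth (refine F) (i - (m.-1)./2%:Z).
Proof. by []. Qed.

Lemma spline_step_steps m F c : steps_le F c -> steps_le (spline_step N eps qsel m F) (c / 2).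
Proof.
move=> /refine_steps/(iter_smooth_steps m.-1)[J1 c1]; split=> i; rewrite !spline_stepE//.
by rewrite addrAC.
Qed.

Lemma spline_step_dist m F c i : steps_le F c ->
  (dmu (spline_step N eps qsel m F (2 * i)%R) (F i) <= (m%:R * c)%:E)%E.
Proof.
move=> Fc; have rc := refine_steps Fc; rewrite spline_stepE.
have H1 := iter_smooth_dist m.-1 (2 * i - (m.-1)./2%:Z) rc.
have H2 := steps_le_absz (2 * i - (m.-1)./2%:Z) (2 * i) rc.
rewrite refine_even in H2.
have c0 : 0 <= c by rewrite -lee_fin; apply: le_trans (Fc.2 i); exact: dmu_ge0.
apply: le_trans (dmu_triangle_le H1 H2) _; rewrite lee_fin.
rewrite (_ : `|_|%N = (m.-1)./2); last by lia.
(* The m - 1 smoothings and the index shift by half of m - 1 make fewer than 2 m moves, each counted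
   as c / 2; for m = 0 there are none. *)
rewrite -mulrDl -natrD; apply: (@le_trans _ _ ((2 * m)%:R * (c / 2))).
  by apply: ler_wpM2r; [lra|rewrite ler_nat; lia].
by rewrite natrM le_eqVlt; apply/orP; left; apply/eqP; field.
Qed.

Variables (m : nat) (F0 : int -> set V) (L : R).
Hypothesis F0L : steps_le F0 L.

Local Notation level := (spline_level N eps qsel m F0).
Local Notation itp := (interpolant N eps qsel m F0).

Lemma spline_level_steps k : steps_le (level k) (L / 2 ^+ k).
Proof.
elim: k => [|k IH]; first by rewrite expr0 divr1.
have := spline_step_steps m IH; rewrite /spline_level iterS => H.
by rewrite exprSr invfM mulrA.
Qed.

Lemma L_ge0 : 0 <= L.
Proof. by rewrite -lee_fin; apply: le_trans (F0L.2 0); exact: dmu_ge0. Qed.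

Lemma pow2_gt0 k : 0 < 2 ^+ k :> R. Proof. exact: exprn_gt0. Qed.

Lemma interpolant_level k (x : R) (i := Num.floor (x * 2 ^+ k)) :
  inJ (itp k x) /\ (dmu (itp k x) (level k i) <= (L / 2 ^+ k)%:E)%E.
Proof.
have [Jk ck] := spline_level_steps k.
have /andP[] := floor_itv (x * 2 ^+ k); rewrite -/i intrD => i1 i2.
have t01 : 0 <= i%:~R + 1 - x * 2 ^+ k <= 1 by lra.
split; first exact: mavg_inJ.
have [H _] := mavg_dist (Jk i) (Jk (i + 1)) t01 (ck i).
apply: le_trans H _; rewrite lee_fin ler_piMl//; last by lra.
by rewrite divr_ge0 ?L_ge0// exprn_ge0.
Qed.

(** In units of L / 2^k: 1 from the interpolant to its left node, m for the refinement step, 1/2 for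
    an index gap of at most one at the finer level, and 1/2 from the finer node to its
    interpolant. *)
Lemma interpolant_step k (x : R) :
  (dmu (itp k x) (itp k.+1 x) <= ((m.+2)%:R * L / 2 ^+ k)%:E)%E.
Proof.
set i := Num.floor (x * 2 ^+ k); set j := Num.floor (x * 2 ^+ k.+1).
have [_ H1] := interpolant_level k x; have [_ H4] := interpolant_level k.+1 x.
have H2 := spline_step_dist m i (spline_level_steps k).
have H3 := steps_le_absz (2 * i) j (spline_level_steps k.+1).
rewrite dmuC in H2; rewrite dmuC in H4.
have H := dmu_triangle_le H1 (dmu_triangle_le H2 (dmu_triangle_le H3 H4)).
apply: le_trans H _; rewrite lee_fin.
have ij : (`|(2 * i - j)%R|%N <= 1)%N.
  by have := floor_double (x * 2 ^+ k); rewrite /i /j exprS mulrCA.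
have c0 : 0 <= L / 2 ^+ k by rewrite divr_ge0 ?L_ge0// exprn_ge0.
have -> : L / 2 ^+ k.+1 = (L / 2 ^+ k) / 2 by rewrite exprSr invfM mulrA.
have : (`|(2 * i - j)%R|%N)%:R * (L / 2 ^+ k / 2) <= 1 * (L / 2 ^+ k / 2).
  apply: ler_wpM2r; first by lra.
  by move: ij; rewrite -(ler_nat R).
have -> : m.+2%:R * L / 2 ^+ k = m%:R * (L / 2 ^+ k) + 2 * (L / 2 ^+ k).
  by rewrite -(addn2 m) natrD -mulrA mulrDl.
lra.
Qed.

(** Of the error 3 L / 2^k, two parts come from passing to the left nodes and one from rounding the
    distance of their indices. *)
Lemma interpolant_lip k (x y : R) :
  (dmu (itp k x) (itp k y) <= (L * `|x - y| + 3 * L / 2 ^+ k)%:E)%E.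
Proof.
set i := Num.floor (x * 2 ^+ k); set j := Num.floor (y * 2 ^+ k).
have [_ H1] := interpolant_level k x; have [_ H3] := interpolant_level k y.
have H2 := steps_le_absz i j (spline_level_steps k); rewrite dmuC in H3.
apply: le_trans (dmu_triangle_le H1 (dmu_triangle_le H2 H3)) _; rewrite lee_fin.
have c0 : 0 <= L / 2 ^+ k by rewrite divr_ge0 ?L_ge0// exprn_ge0.
have ij : `|i - j|%N%:R <= 2 ^+ k * `|x - y| + 1 :> R.
  rewrite -[X in X * _]gtr0_norm ?pow2_gt0// -normrM mulrBr !(mulrC (2 ^+ k)).
  exact: floor_dist.
have := ler_wpM2r c0 ij.
have -> : (2 ^+ k * `|x - y| + 1) * (L / 2 ^+ k) = L * `|x - y| + L / 2 ^+ k.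
  by field; rewrite gt_eqF// pow2_gt0.
lra.
Qed.

Definition spline_limit (x : R) : set V := \bigcup_k \bigcap_j itp (k + j) x.

Let C := (m.+2)%:R * L.

Lemma interpolant_limit_dist k (x : R) :
  (dmu (itp k x) (spline_limit x) <= (2 * C / 2 ^+ k)%:E)%E.
Proof.
have C0 : 0 <= C by rewrite mulr_ge0 ?L_ge0.
apply: le_trans (le_lebo (@liminf_setD _ (itp ^~ x) k)) _.
apply: le_trans (lebo_sigma_subadditive _) _.
pose e := 2 * C / 2 ^+ k.
have e0' : 0 <= e by apply: divr_ge0; [exact: mulr_ge0|exact: exprn_ge0].
(* With e = 2 C / 2^k the j-th term e / 2^(j+1) is C / 2^(k+j), the bound on the j-th later step. *)
apply: le_trans (epsilon_trick0 xpredT e0').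
apply: lee_nneseries => [j _ _|j _]; first exact: lebo_ge0.
rewrite addnS; apply: le_trans (interpolant_step (k + j) x) _.
rewrite lee_fin le_eqVlt; apply/orP; left; apply/eqP.
rewrite /e /C exprD natrX exprS; field.
by rewrite !gt_eqF ?pow2_gt0.
Qed.

Lemma spline_limit_inL x : inL (spline_limit x).
Proof.
split.
  apply: lmeasurable_bigcup => k; apply: lmeasurable_bigcap => j.
  by apply: inJ_lmeasurable; have [] := interpolant_level (k + j) x.
have [J0 _] := interpolant_level 0 x.
apply: (@le_lt_trans _ _ (lebo (itp 0 x) + dmu (itp 0 x) (spline_limit x))%E).
  apply: le_trans (lebo_subU _ _); apply: le_lebo => p lp.
  by case: (pselect (itp 0 x p)) => H; [left|right; right].
rewrite lte_add_pinfty//; first by apply: bounded_lebo_lty; exact: inJ_bounded.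
by apply: le_lt_trans (interpolant_limit_dist 0 x) _; rewrite ltry.
Qed.

Lemma geometric_small (D e : R) : 0 <= D -> 0 < e ->
  exists K, forall k, (K <= k)%N -> D / 2 ^+ k <= e.
Proof.
move=> D0 ep; exists (Num.truncn (D / e)).+1 => k Kk.
rewrite ler_pdivrMr ?pow2_gt0// mulrC -ler_pdivrMr//.
apply: le_trans (ltW (truncnS_gt _)) _; rewrite -natrX ler_nat.
by apply: leq_trans Kk _; apply: ltnW; exact: ltn_expl.
Qed.

Lemma spline_limit_lip (x y : R) :
  (dmu (spline_limit x) (spline_limit y) <= (L * `|x - y|)%:E)%E.
Proof.
apply/lee_addgt0Pr => e ep.
have C0 : 0 <= C by rewrite mulr_ge0 ?L_ge0.
(* At level K the detour through the interpolants costs 2 C at each end and 3 L in the middle, in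
   units of 1 / 2^K. *)
have [|K HK] := @geometric_small (4 * C + 3 * L) e _ ep.
  by have := L_ge0; lra.
have H1 := interpolant_limit_dist K x; have H3 := interpolant_limit_dist K y.
have H2 := interpolant_lip K x y; rewrite dmuC in H1.
apply: le_trans (dmu_triangle_le H1 (dmu_triangle_le H2 H3)) _.
rewrite -EFinD lee_fin; have := HK K (leqnn K); lra.
Qed.

Lemma spline_limit_uniform (e : R) : 0 < e -> exists K : nat, forall k, (K <= k)%N ->
  forall x : R, (dmu (itp k x) (spline_limit x) <= e%:E)%E.
Proof.
move=> ep; have C0 : 0 <= 2 * C by rewrite !mulr_ge0 ?L_ge0.
have [K HK] := geometric_small C0 ep; exists K => k Kk x.
by apply: le_trans (interpolant_limit_dist k x) _; rewrite lee_fin HK.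
Qed.

End Scheme.

(* In dimension 0 every box is the whole one-point space and has volume 1. *)
Lemma lebo_dim0 (R : realType) (A : set 'rV[R]_0) : lebo A = +oo%E.
Proof.
apply/eqP; rewrite -leye_eq; apply: le_ereal_inf_tmp => _ [a [b [_ ->]]].
rewrite leye_eq; apply/eqP/eqyP => r r0.
apply: (@le_trans _ _ (\sum_(0 <= k < (Num.truncn r).+1) (vol (a k) (b k))%:E)%E); last first.
  by apply: nneseries_lim_ge => k _ _; rewrite lee_fin /vol big_ord0.
rewrite (eq_bigr (fun=> 1%:E)) => [|k _]; last by rewrite /vol big_ord0.
by rewrite sumEFin lee_fin big_const_nat subn0 iter_addr_0 ltW// truncnS_gt.
Qed.

Theorem mainTheorem10 (R : realType) (n : nat) :
  exists N0 : R, forall (N eps : R) (qsel : set 'rV[R]_n -> 'rV[R]_n),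
  N0 <= N -> 0 < eps ->
  (* qsel A is a point of A maximizing d_S(., A) over A, whenever one exists *)
  (forall A : set 'rV[R]_n,
     (exists q, A q /\ forall p, A p -> dS A p <= dS A q) ->
     A (qsel A) /\ forall p, A p -> dS A p <= dS A (qsel A)) ->
  forall (m : nat) (F0 : int -> set 'rV[R]_n),
  (1 <= m)%N ->
  (forall i, inJ (F0 i)) ->
  let L := ereal_sup (range (fun i : int => dmu (F0 i) (F0 (i + 1)))) in
  (L < +oo)%E ->
  exists Finf : R -> set 'rV[R]_n,
    (forall x, inL (Finf x)) /\
    (forall e : R, 0 < e -> exists K : nat, forall k : nat, (K <= k)%N ->
       forall x : R, (dmu (interpolant N eps qsel m F0 k x) (Finf x) <= e%:E)%E) /\
    (forall x y : R, (dmu (Finf x) (Finf y) <= L * (`|x - y|)%:E)%E).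
Proof.
(* In dimension 0 even the empty set has infinite [lebo], so no set satisfies [inJ] and the claim is
   vacuous. *)
case: n => [|n'].
  exists 0 => N eps qsel _ _ _ m F0 _ /(_ 0)[_ [_]].
  by rewrite lebo_dim0.
(* N0 = 1 suffices because the exact weights of the distance averages lie in [0, 1]. *)
exists 1 => N eps qsel N1 eps0 qselP m F0 _ JF0 L Loo.
have FL i : (dmu (F0 i) (F0 (i + 1)%R) <= L)%E by apply: ereal_sup_ubound; exists i.
have Lfin : L \is a fin_num.
  by rewrite ge0_fin_numE//; apply: le_trans (FL 0); exact: dmu_ge0.
have F0L : steps_le F0 (fine L) by split=> // i; rewrite fineK.
exists (spline_limit N eps qsel m F0); split; last split.
- exact: (spline_limit_inL N1 eps0 qselP m F0L).
- exact: (spline_limit_uniform N1 eps0 qselP m F0L).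
- move=> x y; rewrite -[X in (_ <= X * _)%E](fineK Lfin) -EFinM.
  exact: (spline_limit_lip N1 eps0 qselP m F0L).
Qed.
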